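(* For every integer $n\ge1$, the generating functions $$G_n(t)=\sum_{k\ge0}b_{2k\,n}\frac{t^{2k}}{(k!)^2},\qquad H_n(t)=\sum_{k\ge0}b_{2k+1\,n}\frac{t^{2k}}{(k!)^2}$$ satisfy $$G_n(t)=\begin{cases}D_{n/2}(t)^2,& n\text{ even},\\ D_{(n-1)/2}(t)\,D_{(n+1)/2}(t),& n\text{ odd},\end{cases}$$ $$H_n(t)=\begin{cases}D_{n/2-1}(t)\,D_{n/2+1}(t),& n\text{ even},\\ D_{(n-1)/2}(t)\,D_{(n+1)/2}(t),& n\text{ odd}.\end{cases}$$
   Context: For $N=2k$ regard the symmetric group $\mathcal S_N$ as acting on the integers from $-k$ to $k$ excluding $0$; for $N=2k+1$ regard $\mathcal S_N$ as acting on the integers from $-k$ to $k$ including $0$. A permutation $\sigma\in\mathcal S_N$ is called odd if $\sigma(-m)=-\sigma(m)$ for all $m$; the odd permutations form a subgroup $\mathcal O_N$ of order $2^k\,k!$ (in both cases). $b_{Nn}$ (also written $b_{N\,n}$) is the number of permutations in $\mathcal O_N$ having no increasing subsequence of length greater than $n$; $b_{0\,n}=1$. For a function $g$ on the unit circle with Fourier coefficients $g_k=\frac1{2\pi}\int_0^{2\pi}g(e^{i\theta})e^{-ik\theta}\,d\theta$, let $T_m(g)=(g_{j-k})_{j,k=0,\dots,m-1}$ be the $m\times m$ Toeplitz matrix. With $f(z)=e^{t(z+z^{-1})}$, set $D_m(t)=\det T_m(f)$ for $m\ge1$ and $D_0(t)=1$. *)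

(* Defs.v *)
From HB Require Import structures.
From mathcomp Require Import all_boot all_order all_algebra perm.
From mathcomp Require Import all_classical all_reals all_analysis.
From mathcomp Require Import complex.
Set Implicit Arguments.
Unset Strict Implicit.
Unset Printing Implicit Defensive.
Import Order.TTheory GRing.Theory Num.Theory.
Import numFieldNormedType.Exports.
Local Open Scope ring_scope.

(* The integers from -k to k, where k = N./2, with 0 excluded when N is even;
   there are N of them. *)
Definition sym_range (N : nat) : seq int :=
  [seq m <- [seq i%:Z - (N./2)%:Z | i <- iota 0 (N./2).*2.+1]
     | odd N || (m != 0)].

Definition sym_point (N : nat) : finType := seq_sub (sym_range N).

(* Oddness in the sense s (- m) = - s m, not the parity of s. The point of
   [sym_point N] opposite to m is the m' with [val m' = - val m]. *)
Definition odd_symmetric (N : nat) (s : {perm sym_point N}) : bool :=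
  [forall m : sym_point N, forall m' : sym_point N,
     (val m' == - val m) ==> (val (s m') == - val (s m))].

Definition odd_perms (N : nat) : {set {perm sym_point N}} :=
  [set s | odd_symmetric s].

(* A subsequence of the word of s is given by its set A of positions. *)
Definition increasing_on (N : nat) (s : {perm sym_point N})
    (A : {set sym_point N}) : bool :=
  [forall x in A, forall y in A, (val x < val y) ==> (val (s x) < val (s y))].

Definition b_count (N n : nat) : nat :=
  #|[set s in odd_perms N |
      [forall A : {set sym_point N}, increasing_on s A ==> (#|A| <= n)%N]]|.

Section Toeplitz.
Variable R : realType.
Local Notation C := R[i].
Local Open Scope complex_scope.

Definition cexp (z : C) : C :=
  (expR (complex.Re z))%:C * (cos (complex.Im z) +i* sin (complex.Im z)).

Definition cintegral (A : set R) (F : R -> C) : C :=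
  (\int[lebesgue_measure]_(x in A) complex.Re (F x))
    +i* (\int[lebesgue_measure]_(x in A) complex.Im (F x)).

Definition fourier_coef (g : C -> C) (k : int) : C :=
  ((2 * pi : R)%:C)^-1 *
  cintegral `[0, 2 * pi]%classic
    (fun theta => g (cexp (0 +i* theta))
                  * cexp (0 +i* (- (k%:~R * theta)))).

Definition toeplitz (m : nat) (g : C -> C) : 'M[C]_m :=
  \matrix_(j < m, k < m) fourier_coef g (j%:Z - k%:Z).

Definition f_symbol (t z : C) : C := cexp (t * (z + z^-1)).

(* For m = 0 this is the determinant of the empty matrix, namely 1. *)
Definition D_toeplitz (m : nat) (t : C) : C := \det (toeplitz m (f_symbol t)).

(* [C^o] carries the topology of the complex modulus. *)
Definition has_sum (u : nat -> C) (l : C) : Prop :=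
  (series (u : nat -> C^o) @ \oo --> (l : C^o))%classic.

End Toeplitz.

(* Main.v *)
(* No Robinson-Schensted correspondence is needed.  Let [A] be the span of the matrix
   coefficients of the action of the permutations of N points on the words of length N in
   n letters.  Antisymmetrizers of n + 1 points kill [A], and colouring the points by the
   length of the longest increasing subsequence ending there yields functions that are
   triangular for the lexicographic order; hence a function of [A] is freely determined by
   its values at the permutations without increasing subsequence longer than n.  Conjugation
   by m |-> - m permutes these, so b_{N n} is its trace on [A].

   On the other hand the trace on [A] of f |-> f (g _ h^-1) is the signed count [Psi g h] of
   pairs of words fixed by g and h whose contents differ by a permutation of (0, .., n-1):
   convolution with [Psi g] is the identity on the class functions of [A], which by
   polarization and triangularization reduces to the functions [pw y], where it follows from
   the Jacobi-Trudi identity.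

   For g = h = (m |-> - m) the fixed words are palindromes, and [Psi g g] becomes a coefficient
   of a Toeplitz determinant for exp (t (z ^ 2 + z ^ -2)) with row and column indices
   0, .., n-1 (N even) or 0, .., n-2, n (N odd).  Separating even from odd indices factors it
   into two Toeplitz determinants for exp (t (z + 1 / z)). *)

From HB Require Import structures.
Require Import Defs.
From mathcomp Require Import all_classical all_reals all_analysis.
From mathcomp Require Import all_boot all_order all_fingroup all_algebra perm.
From mathcomp Require Import complex.
From mathcomp Require Import zify ring lra.
Set Implicit Arguments.
Unset Strict Implicit.
Unset Printing Implicit Defensive.
Import Order.TTheory GRing.Theory Num.Theory.
Import numFieldNormedType.Exports trigo.
Local Open Scope ring_scope.

(** * Words and their contents *)

Section Words.
Variables T I : finType.
Implicit Types (u v z : {ffun T -> I}) (g s : {perm T}).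

Definition wact u s : {ffun T -> I} := [ffun x => u (s x)].

Definition wt u : {ffun I -> nat} := [ffun i => \sum_x (u x == i)]%N.

Lemma wactM u s g : wact (wact u s) g = wact u (g * s)%g.
Proof. by apply/ffunP=> x; rewrite !ffunE permM. Qed.

Lemma wact1 u : wact u 1%g = u.
Proof. by apply/ffunP=> x; rewrite ffunE perm1. Qed.

Lemma wt_wact u s : wt (wact u s) = wt u.
Proof.
apply/ffunP=> i; rewrite !ffunE [RHS](reindex_inj (@perm_inj _ s)) /=.
by apply: eq_bigr => x _; rewrite ffunE.
Qed.

Lemma sum_wt u : (\sum_i wt u i = #|T|)%N.
Proof.
under eq_bigr do rewrite ffunE.
rewrite exchange_big /= -sum1_card; apply: eq_bigr => x _.
by rewrite (bigD1 (u x)) //= eqxx big1 // => i /negPf; rewrite eq_sym => ->.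
Qed.

Lemma wt_le u i : (wt u i <= #|T|)%N.
Proof. by rewrite -(sum_wt u) (bigD1 i) //= leq_addr. Qed.

Lemma prod_wt (R : comPzSemiRingType) (y : I -> R) u :
  \prod_x y (u x) = \prod_i y i ^+ wt u i.
Proof.
rewrite (partition_big u xpredT) //=; apply: eq_bigr => i _.
rewrite (eq_bigr (fun=> y i)) => [|x /eqP->//].
by rewrite prodr_const ffunE -sum1_card big_mkcond.
Qed.

Lemma count_codom u i : count_mem i (codom u) = wt u i.
Proof. by rewrite ffunE codomE count_map -sum1_count big_mkcond big_enum. Qed.

Lemma wt_eqP u v : reflect (exists s, v = wact u s) (wt u == wt v).
Proof.
apply: (iffP eqP) => [euv|[s ->]]; last by rewrite wt_wact.
have pe : perm_eq (fgraph v) (fgraph u).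
  apply/allP => i _; change (count_mem i (codom v) == count_mem i (codom u)).
  by rewrite !count_codom euv.
have [p ep] := tuple_permP pe.
have inj : injective (fun x : T => enum_val (p (enum_rank x))).
  by move=> x y /enum_val_inj/perm_inj/enum_rank_inj.
exists (perm inj); apply/ffunP=> x; rewrite ffunE permE.
have := congr1 (fun t => tnth t (enum_rank x)) (val_inj ep).
by rewrite tnth_mktuple !tnth_fgraph enum_rankK.
Qed.

End Words.

(** * Counting pairs of a word and a permutation fixing it *)

Section OrbitCount.
Variables T I : finType.

Lemma card_permT : #|{perm T}| = (#|T|)`!.
Proof.
rewrite -[in RHS]cardsT -card_perm; apply: eq_card => s.
by rewrite [RHS]unfold_in inE; apply/esym/subsetP => x _; rewrite in_set.
Qed.

Lemma word_of_wt (m : I -> nat) : (\sum_i m i = #|T|)%N ->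
  exists u : {ffun T -> I}, wt u = [ffun i => m i].
Proof.
move=> sm; pose s := flatten [seq nseq (m i) i | i <- enum I].
have cs i : count_mem i s = m i.
  rewrite /s count_flatten -map_comp sumnE big_map big_enum /= (bigD1 i) //=.
  rewrite count_nseq /= eqxx mul1n big1 ?addn0 // => j /negPf nj.
  by rewrite count_nseq /= nj.
have ss : size s == #|T|.
  rewrite -sm /s size_flatten /shape -map_comp sumnE big_map big_enum /=.
  by apply/eqP/eq_bigr => i _; rewrite size_nseq.
exists (Finfun (Tuple ss)); apply/ffunP=> i.
rewrite -count_codom ffunE.
change (count_mem i (fgraph (Finfun (Tuple ss))) = m i).
by rewrite FinfunK /= cs.
Qed.

(** Weak compositions of [d] indexed by [I]. The cap [M] makes their type finite; it excludes
    nothing as soon as [d <= M]. *)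
Definition comps (d M : nat) : {set {ffun I -> 'I_M.+1}} :=
  [set m : {ffun I -> 'I_M.+1} | (\sum_i m i == d)%N].

(** The orbit-stabilizer principle: the words of a given content form one orbit of the permutations
    of [T], so each content accounts for exactly |T|! pairs of a word and a permutation fixing
    it. *)
Lemma fixed_word_sum (V : nmodType) (F : {ffun I -> nat} -> V) (M : nat) :
  (#|T| <= M)%N ->
  \sum_(z : {ffun T -> I}) \sum_(g : {perm T} | wact z g == z) F (wt z) =
  (\sum_(m in comps #|T| M) F [ffun i => m i : nat]) *+ (#|T|)`!.
Proof.
move=> TM; pose tm (z : {ffun T -> I}) : {ffun I -> 'I_M.+1} := [ffun i => inord (wt z i)].
have tmE z : [ffun i => tm z i : nat] = wt z.
  by apply/ffunP=> i; rewrite ffunE [tm z i]ffunE inordK // ltnS (leq_trans (wt_le _ _)).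
rewrite (partition_big tm [in comps #|T| M]) /=; last first.
  move=> z _; rewrite inE -[X in _ == X](sum_wt z); apply/eqP/eq_bigr => i _.
  by rewrite -tmE ffunE.
rewrite -sumrMnl; apply: eq_bigr => m; rewrite inE => /eqP sm.
have [u wtu] := word_of_wt sm.
have tmP z : (tm z == m) = (wt u == wt z).
  apply/eqP/eqP => [e|e]; first by rewrite wtu -tmE e.
  apply/ffunP=> i; apply: val_inj; rewrite [tm z i]ffunE -e wtu ffunE /=.
  by rewrite inordK // ltn_ord.
rewrite (eq_bigl _ _ tmP).
(* Right translation by [s], where [z = wact u s], matches the stabilizer of [z] with the [g]
   carrying [u] to [z]; over all [z] these sets partition the group. *)
transitivity (\sum_(z | wt u == wt z) \sum_(g : {perm T} | wact u g == z) F (wt u)).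
  apply: eq_bigr => z /eqP ez; have /eqP/wt_eqP[s ->] := ez.
  rewrite [RHS](reindex_inj (mulIg s)) /= wt_wact.
  by apply: eq_bigl => g; rewrite wactM.
rewrite (exchange_big_dep xpredT) //= (eq_bigr (fun=> F (wt u))) => [|g _].
  by rewrite sumr_const card_permT wtu.
rewrite (big_pred1 (wact u g)) // => z; rewrite /= [wact u g == z]eq_sym andbC; apply: andb_idr.
by move/eqP->; rewrite wt_wact.
Qed.

End OrbitCount.

(** * The Jacobi-Trudi identity *)

Section JacobiTrudi.
Variables (R : comNzRingType) (n : nat) (y : 'I_n -> R) (M : nat).

Let geo (j : 'I_n) : {poly R} := \poly_(r < M.+1) (y j ^+ r).

(** Truncation of the generating series of the complete symmetric polynomials in [y]; its
    coefficients are exact up to degree [M]. *)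
Definition hpoly : {poly R} := \prod_j \poly_(r < M.+1) (y j ^+ r).

(* The complete symmetric polynomial of degree [a - b] (0 when [a < b]), as long as
   that degree does not exceed [M]. *)
Definition hdiff (a b : nat) : R := if (b <= a)%N then hpoly`_(a - b) else 0.

Lemma coef_hpoly d : hpoly`_d =
  \sum_(m in comps [the finType of 'I_n] d M) \prod_j y j ^+ m j.
Proof.
rewrite /hpoly; under eq_bigr do rewrite poly_def.
rewrite bigA_distr_bigA /= coef_sum [RHS]big_mkcond /=; apply: eq_bigr => m _.
rewrite (eq_bigr (fun j => (y j ^+ m j)%:P * 'X^(m j))) => [|j _]; last by rewrite mul_polyC.
rewrite big_split /= -rmorph_prod mul_polyC coefZ inE prodrXr coefXn eq_sym.
by case: eqP => _; rewrite ?mulr1 ?mulr0.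
Qed.

Let Q (k : 'I_n) : {poly R} := \prod_(l | l != k) (1 - y l *: 'X).

Lemma geo_mul j : geo j * (1 - y j *: 'X) = 1 - y j ^+ M.+1 *: 'X^(M.+1).
Proof.
rewrite /geo poly_def (eq_bigr (fun r : 'I_M.+1 => (y j *: 'X) ^+ r)) => [|r _]; last first.
  by rewrite exprZn.
by rewrite mulrC -opprB mulNr -subrX1 opprB exprZn.
Qed.

(** Multiplying by [Q k] cancels every geometric series except the one of [y k]. The truncation
    errors are multiples of ['X^(M.+1)]. *)
Lemma coef_hpolyQ k m : (m <= M)%N -> (hpoly * Q k)`_m = y k ^+ m.
Proof.
move=> mM; have -> : hpoly * Q k = geo k * \prod_(l | l != k) (1 - y l ^+ M.+1 *: 'X^(M.+1)).
  rewrite /hpoly (bigD1 k) //= -mulrA -big_split /=; congr (_ * _).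
  by apply: eq_bigr => l _; rewrite geo_mul.
have [S ->] : exists S, \prod_(l | l != k) (1 - y l ^+ M.+1 *: 'X^(M.+1)) = 1 + 'X^(M.+1) * S.
  apply: (big_ind (fun p : {poly R} => exists S, p = 1 + 'X^(M.+1) * S)).
  - by exists 0; rewrite mulr0 addr0.
  - move=> p q [S ->] [S' ->]; exists (S + S' + S * ('X^(M.+1) * S')).
    by rewrite mulrDl mul1r mulrDr mulr1 !mulrDr -!addrA; congr (_ + _); rewrite addrCA !mulrA.
  - by move=> l _; exists (- (y l ^+ M.+1)%:P); rewrite mulrN mulrC mul_polyC.
rewrite mulrDr mulr1 mulrCA coefD coefXnM ltnS mM addr0 coef_poly ltnS mM //.
Qed.

Lemma size_Q k : (size (Q k) <= n)%N.
Proof.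
apply: leq_trans (size_poly_prod_leq _ _) _.
have sz l : (size (1 - y l *: 'X : {poly R})%R <= 2)%N.
  apply: leq_trans (size_polyD _ _) _; rewrite size_poly1 size_polyN geq_max /=.
  by apply: leq_trans (size_scale_leq _ _) _; rewrite size_polyX.
have: (\sum_(l | l != k) size (1 - y l *: 'X : {poly R})%R <= \sum_(l : 'I_n | l != k) 2)%N.
  by apply: leq_sum => l _.
rewrite sum_nat_const (eq_card (B := predC1 k)) // cardC1 card_ord.
have := ltn_ord k; set S := (\sum_(_ | _) _)%N; lia.
Qed.

Lemma hdiff_Q k m : (m <= M)%N -> \sum_(j < n) hdiff m j * (Q k)`_j = y k ^+ m.
Proof.
move=> mM; rewrite -(coef_hpolyQ k mM) coefMr.
pose F j := hpoly`_(m - j) * (Q k)`_j.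
rewrite (eq_bigr (fun j : 'I_n => if (j < m.+1)%N then F j else 0)) => [|j _]; last first.
  by rewrite /hdiff ltnS; case: ifP; rewrite ?mul0r.
rewrite -big_mkcond /= (big_ord_widen_cond (n + m.+1) (fun j => (j < m.+1)%N) F) ?leq_addr //.
rewrite (big_ord_widen (n + m.+1) F) ?leq_addl // [RHS]big_mkcond [LHS]big_mkcond /=.
apply: eq_bigr => j _; case: (j < m.+1)%N => //=; case: ltnP => // nj.
by rewrite /F (nth_default _ (leq_trans (size_Q k) nj)) mulr0.
Qed.

Lemma hpoly0 : hpoly`_0 = 1.
Proof.
rewrite -horner_coef0 horner_prod big1 // => j _.
by rewrite horner_coef0 coef_poly expr0.
Qed.

(** By [hdiff_Q] the matrix of powers is the product of a matrix of complete symmetric polynomials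
    and a matrix [QQ] that does not involve [gam]. Taking [gam i = i] identifies [\det QQ] with the
    Vandermonde determinant. *)
Lemma jacobi_trudi (gam : 'I_n -> nat) :
  (n <= M.+1)%N -> (forall i, (gam i <= M)%N) ->
  \det (\matrix_(i, k) y k ^+ gam i) =
  \det (\matrix_(i < n, j < n) hdiff (gam i) j) * \det (\matrix_(i < n, k < n) y k ^+ i).
Proof.
move=> nM gamM.
pose QQ : 'M[R]_n := \matrix_(j, k) (Q k)`_j.
have step (f : 'I_n -> nat) : (forall i, (f i <= M)%N) ->
    \det (\matrix_(i, k) y k ^+ f i) = \det (\matrix_(i < n, j < n) hdiff (f i) j) * \det QQ.
  move=> fM; rewrite -det_mulmx; congr (\det _); apply/matrixP=> i k.
  by rewrite !mxE -(hdiff_Q k (fM i)); apply: eq_bigr => j _; rewrite !mxE.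
rewrite step // (step (fun i => i)) => [|i]; last by rewrite -ltnS (leq_trans _ nM).
(* For the exponents [0, .., n-1] the entries [hdiff i j] form a unitriangular matrix. *)
rewrite [X in _ = _ * (X * _)]det_trig; last first.
  by apply/is_trig_mxP => i j ij; rewrite mxE /hdiff leqNgt ij.
by rewrite big1 ?mul1r // => i _; rewrite mxE /hdiff leqnn subnn hpoly0.
Qed.

End JacobiTrudi.

(** * The kernel Psi *)

Section Kernel.
Variables (T : finType) (n : nat).
Implicit Types (g h : {perm T}) (u v w : {ffun T -> 'I_n}).

(** The power sum symmetric polynomial of the cycle type of [g]: a fixed word is constant on each
    cycle. *)
Definition pw (R : comNzRingType) (y : 'I_n -> R) g : R :=
  \sum_(u : {ffun T -> 'I_n} | wact u g == u) \prod_x y (u x).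

(** In terms of irreducible characters this is the sum of chi(g) chi(h) over the partitions of
    [#|T|] with at most [n] parts, by the determinantal formula for these characters. *)
Definition Psi (R : comNzRingType) g h : R :=
  \sum_(s : 'S_n) (-1) ^+ s *
    \sum_(u : {ffun T -> 'I_n} | wact u g == u)
      \sum_(v : {ffun T -> 'I_n} | wact v h == v)
        [forall i, wt u i + i == wt v i + s i]%N%:R.

Variables (R : comNzRingType) (y : 'I_n -> R).

Definition vdm : R := \det (\matrix_(i < n, k < n) y k ^+ i).

Lemma pw_perm (t : 'S_n) g : pw (fun i => y (t i)) g = pw y g.
Proof.
pose f (t : 'S_n) u : {ffun T -> 'I_n} := [ffun x => t (u x)].
have fK : cancel (f t^-1%g) (f t).
  by move=> u; apply/ffunP=> x; rewrite !ffunE permKV.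
have fK' : cancel (f t) (f t^-1%g).
  by move=> u; apply/ffunP=> x; rewrite !ffunE permK.
rewrite /pw (reindex (f t^-1%g)) /=; last by exists (f t) => u _; rewrite ?fK ?fK'.
apply: eq_big => [u|u _]; last by apply: eq_bigr => x _; rewrite ffunE permKV.
rewrite -[RHS](can_eq fK); congr (_ == _).
by apply/ffunP => x; rewrite !ffunE.
Qed.

(** When the determinant is expanded over [t], the words contribute a term of the Vandermonde
    determinant times [pw] in permuted variables, and [pw] is symmetric. *)
Lemma sum_det_pw g :
  \sum_(u : {ffun T -> 'I_n} | wact u g == u)
    \det (\matrix_(i < n, k < n) y k ^+ (wt u i + i)) = vdm * pw y g.
Proof.
rewrite exchange_big /= /vdm [in RHS]/determinant mulr_suml; apply: eq_bigr => t _.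
rewrite -(pw_perm t) /pw mulr_sumr; apply: eq_bigr => u _.
rewrite -mulrA; congr (_ * _); rewrite (prod_wt (fun i => y (t i)) u) -big_split /=.
by apply: eq_bigr => i _; rewrite !mxE exprD mulrC.
Qed.

Lemma sum_pair_words (g : {perm T}) (F : {ffun T -> 'I_n} -> {ffun T -> 'I_n} -> R) :
  \sum_(v : {ffun T -> 'I_n} | wact v g == v) \sum_(w : {ffun T -> 'I_n} | wact w g == w) F v w =
  \sum_(z : {ffun T -> 'I_n * 'I_n} | wact z g == z) F [ffun x => (z x).1] [ffun x => (z x).2].
Proof.
rewrite pair_big /=.
pose f (z : {ffun T -> 'I_n * 'I_n}) : {ffun T -> 'I_n} * {ffun T -> 'I_n} :=
  ([ffun x => (z x).1], [ffun x => (z x).2]).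
pose f' (p : {ffun T -> 'I_n} * {ffun T -> 'I_n}) : {ffun T -> 'I_n * 'I_n} :=
  [ffun x => (p.1 x, p.2 x)].
rewrite (reindex f) /=; last first.
  exists f' => [z _|[p q] _]; first by apply/ffunP=> x; rewrite !ffunE -surjective_pairing.
  by congr (_, _); apply/ffunP=> x; rewrite !ffunE.
apply: eq_bigl => z; apply/andP/eqP => [[/eqP e1 /eqP e2]|e].
  apply/ffunP=> x; rewrite ffunE; apply: injective_projections.
    by move/ffunP: e1 => /(_ x); rewrite !ffunE.
  by move/ffunP: e2 => /(_ x); rewrite !ffunE.
by split; apply/eqP/ffunP=> x; rewrite !ffunE -[in RHS]e ffunE.
Qed.

(** Picking a monomial from each factor gives a matrix of exponents with row sums [a i - b i]. The
    balance hypothesis makes its total [#|T|], so that it can be read as the content of a word in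
    pairs of letters. *)
Lemma prod_hdiff (M : nat) (a b : 'I_n -> nat) :
  (\sum_i a i = \sum_i b i + #|T|)%N -> (forall i, a i <= M)%N -> (#|T| <= M)%N ->
  \prod_i hdiff y M (a i) (b i) =
  \sum_(m in comps ('I_n * 'I_n)%type #|T| M)
     [forall i, a i == \sum_j m (i, j) + b i]%N%:R * \prod_p y p.2 ^+ m p.
Proof.
move=> sab aM TM.
have hE i : hdiff y M (a i) (b i) = \sum_(m : {ffun 'I_n -> 'I_M.+1})
    (a i == \sum_j m j + b i)%N%:R * \prod_j y j ^+ m j.
  rewrite /hdiff; case: leqP => [le|lt].
    rewrite coef_hpoly big_mkcond /=; apply: eq_bigr => m _; rewrite inE.
    rewrite -(eqn_add2r (b i)) subnK // eq_sym.
    by case: eqP => _; rewrite ?mul1r ?mul0r.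
  rewrite big1 // => m _; case: eqP => [e|]; last by rewrite mul0r.
  by move: lt; rewrite e; lia.
under eq_bigr do rewrite hE.
rewrite bigA_distr_bigA /=.
pose f (m : {ffun 'I_n * 'I_n -> 'I_M.+1}) : {ffun 'I_n -> {ffun 'I_n -> 'I_M.+1}} :=
  [ffun i => [ffun j => m (i, j)]].
pose f' (m : {ffun 'I_n -> {ffun 'I_n -> 'I_M.+1}}) : {ffun 'I_n * 'I_n -> 'I_M.+1} :=
  [ffun p => m p.1 p.2].
rewrite (reindex f) /=; last first.
  exists f' => m _; first by apply/ffunP=> -[i j]; rewrite !ffunE.
  by apply/ffunP=> i; apply/ffunP=> j; rewrite !ffunE.
rewrite [RHS]big_mkcond; apply: eq_bigr => m _; rewrite inE big_split /=.
have -> : \prod_i \prod_j y j ^+ f m i j = \prod_p y p.2 ^+ m p.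
  by rewrite pair_big; apply: eq_bigr => -[i j] _; rewrite !ffunE.
have -> : \prod_i (a i == \sum_j f m i j + b i)%N%:R =
          [forall i, a i == \sum_j m (i, j) + b i]%N%:R :> R.
  have e i : (\sum_j f m i j = \sum_j m (i, j))%N by apply: eq_bigr => j _; rewrite !ffunE.
  case: forallP => [al|/forallP]; first by rewrite big1 // => i _; rewrite e al.
  by rewrite negb_forall => /existsP[i ni]; rewrite (bigD1 i) //= e (negPf ni) mul0r.
case: forallP => [al|_]; last by rewrite mul0r if_same.
suff -> : (\sum_p m p == #|T|)%N by [].
rewrite (eq_bigr (fun p => m (p.1, p.2) : nat)) => [|[i j]//].
rewrite -(pair_big xpredT xpredT (fun i j => m (i, j) : nat)) /=.
rewrite -(eqn_add2l (\sum_i b i)) -sab addnC -big_split /=; apply/eqP/eq_bigr => i _.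
by rewrite -(eqP (al i)).
Qed.

(** A word fixed by [g] from each factor is one fixed word over pairs of letters, so
    [fixed_word_sum] applies. The row sums of its content prescribe [wt v], and its column sums
    carry the weights in [y]. *)
Lemma sum_fixed_pw (M : nat) u (s : 'S_n) : (#|T| + n <= M)%N ->
  \sum_g (\sum_(v : {ffun T -> 'I_n} | wact v g == v)
             [forall i, wt u i + i == wt v i + s i]%N%:R) * pw y g =
  (\prod_i hdiff y M (wt u i + i) (s i)) *+ (#|T|)`!.
Proof.
move=> TM; rewrite prod_hdiff; first last.
- by lia.
- by move=> i; have := wt_le u i; have := ltn_ord i; lia.
- by rewrite big_split /= sum_wt addnC [in LHS](reindex_inj (@perm_inj _ s)).
pose F (m : {ffun 'I_n * 'I_n -> nat}) : R :=
  [forall i, wt u i + i == \sum_j m (i, j) + s i]%N%:R * \prod_p y p.2 ^+ m p.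
transitivity ((\sum_(m in comps ('I_n * 'I_n)%type #|T| M) F [ffun p => m p : nat]) *+ (#|T|)`!); last first.
  congr (_ *+ _); apply: eq_bigr => m _; rewrite /F; congr (_%:R * _).
    congr (nat_of_bool _); apply: eq_forallb => i; congr (_ == (_ + _)%N).
    by apply: eq_bigr => j _; rewrite ffunE.
  by apply: eq_bigr => p _; rewrite ffunE.
rewrite -(@fixed_word_sum T _ _ F); last by lia.
rewrite [RHS](exchange_big_dep xpredT) //=; apply: eq_bigr => g _.
rewrite /pw mulr_suml; under [LHS]eq_bigr do rewrite mulr_sumr.
rewrite sum_pair_words; apply: eq_bigr => z _; rewrite /F; congr (_%:R * _).
  congr (nat_of_bool _); apply: eq_forallb => i; congr (_ == (_ + _)%N).
  rewrite ffunE; under [RHS]eq_bigr do rewrite ffunE.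
  rewrite exchange_big /=; apply: eq_bigr => x _; rewrite ffunE.
  rewrite (bigD1 (z x).2) //= big1 ?addn0 => [|j /negPf nj].
    by rewrite [z x in RHS]surjective_pairing xpair_eqE eqxx andbT.
  by rewrite [z x]surjective_pairing xpair_eqE [_.2 == j]eq_sym nj andbF.
rewrite -(prod_wt (fun p => y p.2) z); by apply: eq_bigr => x _; rewrite ffunE.
Qed.

(** Summing over [g'] first turns the signed sum over [s] into a determinant of complete symmetric
    polynomials. [jacobi_trudi] converts it, times [vdm], into a determinant of powers, and
    [sum_det_pw] sums these over the words fixed by [g]. *)
Lemma Psi_pw g :
  (\sum_g' Psi R g g' * pw y g') * vdm = (pw y g *+ (#|T|)`!) * vdm.
Proof.
pose M := (#|T| + n)%N.
have step : \sum_g' Psi R g g' * pw y g' =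
   \sum_(u : {ffun T -> 'I_n} | wact u g == u)
      \det (\matrix_(i < n, j < n) hdiff y M (wt u i + i) j) *+ (#|T|)`!.
  rewrite /Psi; under eq_bigr do rewrite mulr_suml.
  rewrite exchange_big /= /determinant.
  under [RHS]eq_bigr do rewrite -sumrMnl.
  rewrite [RHS]exchange_big /=; apply: eq_bigr => s _.
  under eq_bigr do rewrite -mulrA mulr_suml mulr_sumr.
  rewrite exchange_big /=; apply: eq_bigr => u _.
  rewrite -mulr_sumr (@sum_fixed_pw M) //. rewrite -mulrnAr; congr (_ * (_ *+ _)).
  by apply: eq_bigr => i _; rewrite mxE.
rewrite step mulr_suml.
transitivity ((vdm * pw y g) *+ (#|T|)`!); last by rewrite mulrC -mulrnAl.
rewrite -sum_det_pw -sumrMnl; apply: eq_bigr => u _.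
rewrite (jacobi_trudi y (M := M)).
- by rewrite -mulrnAl.
- by rewrite /M; lia.
- by move=> i; rewrite /M; have := wt_le u i; have := ltn_ord i; lia.
Qed.
End Kernel.

Section KernelField.
Variables (T : finType) (n : nat).
Implicit Types (g h : {perm T}) (u v w : {ffun T -> 'I_n}).

Lemma rmorph_Psi (R S : comNzRingType) (f : {rmorphism R -> S}) g h :
  f (Psi n R g h) = Psi n S g h.
Proof.
rewrite rmorph_sum; apply: eq_bigr => s _; rewrite rmorphM rmorph_sign; congr (_ * _).
rewrite rmorph_sum; apply: eq_bigr => u _.
by rewrite rmorph_sum; apply: eq_bigr => v _; rewrite rmorph_nat.
Qed.

Lemma rmorph_pw (R S : comNzRingType) (f : {rmorphism R -> S}) (y : 'I_n -> R) g :
  f (pw y g) = pw (fun i => f (y i)) g.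
Proof. by rewrite rmorph_sum; apply: eq_bigr => u _; rewrite rmorph_prod. Qed.

(* The Vandermonde factor of [Psi_pw] is removed by perturbing [y] to [y + (0, .., n-1) X]. *)
Lemma Psi_pw_field (F : numFieldType) (y : 'I_n -> F) g :
  \sum_g' Psi n F g g' * pw y g' = pw y g *+ (#|T|)`!.
Proof.
pose yy (i : 'I_n) : {poly F} := (y i)%:P + i%:R%:P * 'X.
have vdm_neq0 : vdm yy != 0.
  have -> : vdm yy = \det (Vandermonde n (\row_j yy j)).
    by congr (\det _); apply/matrixP=> i k; rewrite !mxE.
  rewrite det_Vandermonde; apply/prodf_neq0 => i _; apply/prodf_neq0 => j ij.
  rewrite !mxE; apply: contraTneq ij => /(congr1 (fun p : {poly F} => p`_1)).
  rewrite /yy !(coefB, coefD, coefMX, coefC) /= !add0r => /eqP.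
  by rewrite subr_eq0 eqr_nat => /eqP ->; rewrite ltnn.
have yyK i : horner_eval 0 (yy i) = y i.
  by rewrite /horner_eval /yy !hornerE ?mulr0 ?addr0.
have /(congr1 (horner_eval 0)) := mulIf vdm_neq0 (Psi_pw yy g).
rewrite rmorph_sum rmorphMn rmorph_pw => e.
transitivity (pw (fun i => horner_eval 0 (yy i)) g *+ (#|T|)`!); last first.
  by congr (_ *+ _); apply: eq_bigr => u _; apply: eq_bigr => x _; exact: yyK.
rewrite -e; apply: eq_bigr => g' _; rewrite rmorphM rmorph_Psi rmorph_pw; congr (_ * _).
by apply: eq_bigr => u _; apply: eq_bigr => x _; exact/esym/yyK.
Qed.

(** The trace of the tensor power of [X] indexed by [T], composed with the permutation of the tensor
    factors by [g]. *)
Definition mxw (R : comNzRingType) (X : 'M[R]_n) g : R :=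
  \sum_(w : {ffun T -> 'I_n}) \prod_x X (w x) (w (g x)).

(** Cyclicity of the trace, as tensor powers commute with permutations of the factors. *)
Lemma mxw_mulC (R : comNzRingType) (A B : 'M[R]_n) g :
  mxw (A *m B) g = mxw (B *m A) g.
Proof.
have E (A' B' : 'M[R]_n) : mxw (A' *m B') g =
    \sum_(w : {ffun T -> 'I_n}) \sum_(a : {ffun T -> 'I_n})
      \prod_x (A' (w x) (a x) * B' (a x) (w (g x))).
  by apply: eq_bigr => w _; rewrite -(bigA_distr_bigA (fun x j => A' (w x) j * B' j (w (g x)))); apply: eq_bigr => x _; rewrite mxE.
rewrite !E exchange_big /=; apply: eq_bigr => a _.
have wactK (s : {perm T}) : cancel ((@wact T 'I_n)^~ s) (fun u => wact u s^-1)%g.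
  by move=> u; rewrite wactM mulVg wact1.
have wactKV (s : {perm T}) : cancel (fun u => wact u s^-1)%g ((@wact T 'I_n)^~ s).
  by move=> u; rewrite wactM mulgV wact1.
rewrite [RHS](reindex ((@wact T 'I_n)^~ g)) /=; last first.
  by exists (fun u => wact u g^-1)%g => u _; rewrite ?wactK ?wactKV.
apply: eq_bigr => w _; rewrite !big_split /= mulrC; congr (_ * _).
  by apply: eq_bigr => x _; rewrite ffunE.
rewrite (reindex_inj (@perm_inj _ g)) /=.
by apply: eq_bigr => x _; rewrite ffunE.
Qed.

Lemma mxw_conj (R : comNzRingType) (P X Q : 'M[R]_n) g :
  Q *m P = 1%:M -> mxw (P *m X *m Q) g = mxw X g.
Proof. by move=> QP; rewrite mxw_mulC mulmxA QP mul1mx. Qed.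

(** A nonzero term needs [w (g x) <= w x] for all [x]. Both sides have the same sum over [T], so
    equality holds throughout and [w] is fixed by [g]. *)
Lemma mxw_trig (R : comNzRingType) (X : 'M[R]_n) g :
  is_trig_mx X -> mxw X g = pw (fun i => X i i) g.
Proof.
move/is_trig_mxP => trX; rewrite /mxw /pw [RHS]big_mkcond; apply: eq_bigr => w _.
case: eqP => [e|ne].
  by apply: eq_bigr => x _; have /ffunP/(_ x) := e; rewrite ffunE => ->.
have [x lt] : exists x, (w x < w (g x))%N.
  apply/existsP; apply: contraT; rewrite negb_exists => /forallP le.
  case: ne; apply/ffunP=> x; rewrite ffunE; apply/val_inj/eqP => /=.
  have: (\sum_x w (g x) == \sum_x w x)%N by rewrite [X in _ == X](reindex_inj (@perm_inj _ g)).
  have leqif_wg x0 : true -> (w (g x0) <= w x0 ?= iff (w (g x0) == w x0))%N.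
    by split=> //; rewrite leqNgt.
  by rewrite (leqif_sum leqif_wg) => /forallP/(_ x).
by rewrite (bigD1 x) //= trX ?mul0r.
Qed.

(** Over an algebraically closed field [X] is conjugate to a triangular matrix, and [mxw] then
    reduces to [pw] of the diagonal. *)
Lemma Psi_mxw (F : numClosedFieldType) (X : 'M[F]_n) g : (0 < n)%N ->
  \sum_g' Psi n F g g' * mxw X g' = mxw X g *+ (#|T|)`!.
Proof.
move=> n_gt0; have [P uP /= trig] := Schur X n_gt0.
pose D i := conjmx P X i i.
have E g' : mxw X g' = pw D g'.
  by rewrite -mxw_trig // conjumx ?unitarymx_unit // mxw_conj // mulVmx ?unitarymx_unit.
under eq_bigr do rewrite E.
by rewrite Psi_pw_field E.
Qed.
End KernelField.

(** * Matrix coefficients of the action on words *)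

Section Span.
Variables (T : finType) (n : nat) (R : comNzRingType).
Implicit Types (f : {perm T} -> R) (g h : {perm T}) (u v w : {ffun T -> 'I_n}).

(* The span of the matrix coefficients [s |-> (u o s == v)] of the action of the
   permutations of [T] on the words of length [T] in [n] letters. *)
Definition wspan f : Prop :=
  exists c : {ffun T -> 'I_n} -> {ffun T -> 'I_n} -> R,
    forall s, f s = \sum_u c u (wact u s).

Lemma wspan_mull f g : wspan f -> wspan (fun s => f (g * s)%g).
Proof.
by move=> [c fE]; exists (fun u v => c u (wact v g)) => s; rewrite fE;
  apply: eq_bigr => u _; rewrite wactM.
Qed.

Lemma wact_bij g : bijective ((@wact T 'I_n)^~ g).
Proof.
by exists (fun u => wact u g^-1)%g => u; rewrite wactM ?mulgV ?mulVg wact1.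
Qed.

Lemma wspan_mulr f g : wspan f -> wspan (fun s => f (s * g)%g).
Proof.
move=> [c fE]; exists (fun u v => c (wact u g^-1)%g v) => s; rewrite fE.
rewrite [RHS](reindex _ (onW_bij _ (wact_bij g))) /=; apply: eq_bigr => u _.
by rewrite !wactM mulVg wact1.
Qed.

Lemma wspan_inv f : wspan f -> wspan (fun s => f s^-1)%g.
Proof.
move=> [c fE]; exists (fun u v => c v u) => s; rewrite fE.
rewrite (reindex _ (onW_bij _ (wact_bij s))) /=; apply: eq_bigr => u _.
by rewrite wactM mulVg wact1.
Qed.

Lemma wspan_sum (J : finType) (P : pred J) (F : J -> {perm T} -> R) :
  (forall j, wspan (F j)) -> wspan (fun s => \sum_(j | P j) F j s).
Proof.
move=> /fin_all_exists[c cE]; exists (fun u v => \sum_(j | P j) c j u v) => s.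
by rewrite exchange_big /=; apply: eq_bigr => j _.
Qed.

Lemma wspan_sub f f' : wspan f -> wspan f' -> wspan (fun s => f s - f' s).
Proof.
move=> [c fE] [c' fE']; exists (fun u v => c u v - c' u v) => s.
by rewrite fE fE' sumrB.
Qed.

Lemma wspan_scale (a : R) f : wspan f -> wspan (fun s => a * f s).
Proof.
move=> [c fE]; exists (fun u v => a * c u v) => s.
by rewrite fE mulr_sumr.
Qed.

Lemma wspan_Psi g : wspan (Psi n R g).
Proof.
apply: wspan_sum => s; apply: wspan_scale; apply: wspan_sum => u.
exists (fun v w => if w == v then [forall i, wt u i + i == wt v i + s i]%N%:R else 0) => h.
by rewrite big_mkcond.
Qed.

Lemma Psi_conjr g h s : Psi n R g (s * h * s^-1)%g = Psi n R g h.
Proof.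
apply: eq_bigr => t _; congr (_ * _); apply: eq_bigr => u _.
rewrite [RHS](reindex _ (onW_bij _ (wact_bij s^-1%g))) /=.
apply: eq_big => [v|v _]; last by rewrite wt_wact.
rewrite !wactM -[LHS](bij_eq (wact_bij s^-1)%g) /= wactM.
by rewrite !mulgA mulVg mul1g.
Qed.

(* Expand the product over [i] of [1 + (0 if i \in C else -1)]. *)
Lemma prod_mem_alt (C : {set T}) :
  \sum_(S : {set T}) (-1) ^+ #|~: S| * (C \subset S)%:R = (C == setT)%:R :> R.
Proof.
transitivity (\prod_i (1 + (if i \in C then 0 else -1)) : R).
  rewrite bigA_distr; apply: eq_bigr => S _.
  rewrite (bigID [in S]) /= big1 ?mul1r => [|i ->//].
  case: (boolP (C \subset S)) => [CS|/subsetPn[i iC iS]]; last first.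
    by rewrite mulr0 (bigD1 i) //= (negPf iS) iC mul0r.
  rewrite mulr1 (eq_bigr (fun=> -1)) => [|i iS].
    by rewrite prodr_const; congr (_ ^+ _); apply: eq_card => i; rewrite !inE.
  by rewrite (negPf iS) ifN //; apply: contraNN iS => /(subsetP CS).
case: eqP => [->|/eqP CT]; first by rewrite big1 // => i _; rewrite inE addr0.
have [i iC] : exists i, i \notin C.
  by apply/existsP; rewrite -negb_forall; apply: contra CT => /forallP aC; rewrite -subTset; apply/subsetP => i _.
by rewrite (bigD1 i) //= (negPf iC) subrr mul0r.
Qed.

Lemma sum_injective_perm (V : nmodType) (F : {ffun T -> T} -> V) :
  \sum_(r : {ffun T -> T} | injectiveb r) F r = \sum_(s : {perm T}) F (pval s).
Proof.
rewrite (reindex (@pval T)) /=.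
  by apply: eq_bigl => s; rewrite (valP s).
pose perm_of := insubd (1%g : {perm T}).
by exists perm_of => r rP; first apply: val_inj; apply: insubdK.
Qed.


(** [mxw] of a sum of matrix units expands over all maps [r] from [T] to [T] choosing a unit for
    each tensor factor; inclusion-exclusion over [S] keeps the surjective ones, that is the
    permutations. What remains is a sum over the conjugates of [g] of a matrix coefficient. *)
Lemma polarization (u v : {ffun T -> 'I_n}) g :
  \sum_(S : {set T}) (-1) ^+ #|~: S| * mxw (\sum_(i in S) delta_mx (u i) (v i)) g =
  \sum_(r : {perm T}) (wact (wact u r) g == wact v r)%:R :> R.
Proof.
pose d (w : {ffun T -> 'I_n}) (j i : T) : R := delta_mx (u i) (v i) (w j) (w (g j)).
have E (S : {set T}) : mxw (\sum_(i in S) delta_mx (u i) (v i)) g =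
    \sum_(r : {ffun T -> T}) (r @: setT \subset S)%:R * \sum_w \prod_j d w j (r j) :> R.
  under [RHS]eq_bigr do rewrite mulr_sumr.
  rewrite exchange_big /=; apply: eq_bigr => w _.
  transitivity (\prod_j \sum_i (i \in S)%:R * d w j i).
    apply: eq_bigr => j _; rewrite summxE big_mkcond; apply: eq_bigr => i _.
    by case: (i \in S); rewrite ?mul1r ?mul0r.
  rewrite bigA_distr_bigA /=; apply: eq_bigr => r _; rewrite big_split /=; congr (_ * _).
  case: (boolP (r @: setT \subset S)) => [rS|nrS].
    by rewrite big1 // => j _; rewrite (subsetP rS) ?imset_f.
  case/subsetPn: nrS => _ /imsetP[j _ ->] rjS; by rewrite (bigD1 j) //= (negPf rjS) mul0r.
under eq_bigr do rewrite E mulr_sumr.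
rewrite exchange_big /=.
transitivity (\sum_(r : {ffun T -> T} | injectiveb r) \sum_w \prod_j d w j (r j)).
  rewrite [RHS]big_mkcond; apply: eq_bigr => r _.
  under eq_bigr do rewrite mulrA; rewrite -mulr_suml prod_mem_alt.
  have -> : (r @: setT == setT) = injectiveb r.
    rewrite eqEcard subsetT /= cardsT leq_eqVlt ltnNge.
    have -> : (#|r @: setT| <= #|T|)%N by rewrite (leq_trans (leq_imset_card _ _)) ?cardsT.
    rewrite orbF eq_sym -cardsT; apply/imset_injP/injectiveP => [inj i j|inj i j _ _]; last exact: inj.
    by apply: inj; rewrite inE.
  by case: ifP; rewrite ?mul1r ?mul0r.
rewrite sum_injective_perm; apply: eq_bigr => r _.
have dE w j : d w j (pval r j) = ((w j == wact u r j) && (w (g j) == wact v r j))%:R.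
  by rewrite /d mxE !ffunE pvalE.
rewrite (bigD1 (wact u r)) //= [X in _ + X]big1 ?addr0 => [|w nw].
  case: eqP => [/ffunP e|ne].
    by apply: big1 => j _; rewrite dE eqxx -e [wact (wact u r) g j]ffunE eqxx.
  have [j nj] : exists j, wact u r (g j) != wact v r j.
    apply/existsP; rewrite -negb_forall; apply/negP => /forallP e; apply: ne.
    by apply/ffunP=> j; rewrite [LHS]ffunE (eqP (e j)).
  by rewrite (bigD1 j) //= dE (negPf nj) andbF mul0r.
have [j nj] : exists j, w j != wact u r j.
  apply/existsP; rewrite -negb_forall; apply: contra nw => /forallP e.
  by apply/eqP/ffunP=> j; apply/eqP.
by rewrite (bigD1 j) //= dE (negPf nj) mul0r.
Qed.

End Span.

(** * Traces on the span of matrix coefficients *)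

Section Trace.
Variables (T : finType) (n : nat) (F : numClosedFieldType).
Hypothesis n_gt0 : (0 < n)%N.
Implicit Types (f : {perm T} -> F) (g h : {perm T}).

Local Notation wspan := (@wspan T n F).

(** A class function equals its average over conjugations, which by [polarization] is a linear
    combination of functions [mxw X]; these are handled by [Psi_mxw]. *)
Lemma Psi_classfun f : wspan f -> (forall s g, f (s * g * s^-1)%g = f g) ->
  forall g, \sum_g' Psi n F g g' * f g' = f g *+ (#|T|)`!.
Proof.
move=> [c fE] fclass.
have E g : f g *+ (#|T|)`! = \sum_u \sum_v c u v *
    \sum_(S : {set T}) (-1) ^+ #|~: S| * mxw (\sum_(i in S) delta_mx (u i) (v i)) g.
  under eq_bigr do under eq_bigr do rewrite polarization.
  transitivity (\sum_(r : {perm T}) f (r * g * r^-1)%g).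
    by under eq_bigr do rewrite fclass; rewrite sumr_const card_permT.
  under [LHS]eq_bigr do rewrite fE.
  rewrite exchange_big /=; apply: eq_bigr => u _.
  under [RHS]eq_bigr do rewrite mulr_sumr.
  rewrite [RHS]exchange_big [RHS](reindex_inj invg_inj) /=; apply: eq_bigr => r _.
  have e v : (wact (wact u r^-1) g == wact v r^-1)%g = (wact u (r * g * r^-1)%g == v).
    by rewrite -[RHS](bij_eq (wact_bij n r^-1)%g) !wactM !mulgA mulVg mul1g.
  under [RHS]eq_bigr do rewrite e.
  by rewrite [RHS](bigD1 (wact u (r * g * r^-1)%g)) //= eqxx mulr1 big1 ?addr0 //
    => v /negPf nv; rewrite eq_sym nv mulr0.
move=> g; apply: (@mulIf _ (#|T|)`!%:R); first by rewrite pnatr_eq0 -lt0n fact_gt0.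
rewrite mulr_suml.
under eq_bigr do rewrite -mulrA [f _ * _]mulr_natr E mulr_sumr.
rewrite exchange_big /= mulr_natr E -sumrMnl; apply: eq_bigr => u _.
under eq_bigr do rewrite mulr_sumr.
rewrite exchange_big /= -sumrMnl; apply: eq_bigr => v _.
under eq_bigr do rewrite mulrCA; rewrite -mulr_sumr -mulrnAr; congr (_ * _).
under [LHS]eq_bigr do rewrite mulr_sumr.
rewrite [LHS]exchange_big /= -sumrMnl; apply: eq_bigr => S _.
by under eq_bigr do rewrite mulrCA; rewrite -mulr_sumr -mulrnAr Psi_mxw.
Qed.

Variables (B : {pred {perm T}}) (fd : {perm T} -> {perm T} -> F).
Hypothesis fd_span : forall b, wspan (fd b).
Hypothesis fd_dual : {in B &, forall b b', fd b b' = (b == b')%:R}.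
Hypothesis B_sep : forall f, wspan f -> {in B, forall b, f b = 0} -> forall s, f s = 0.

Lemma wspan_expand f : wspan f -> forall s, f s = \sum_(b in B) f b * fd b s.
Proof.
move=> fA s; apply/eqP; rewrite -subr_eq0; apply/eqP; move: s.
apply: B_sep => [|b bB].
  by apply: wspan_sub => //; apply: wspan_sum => b; apply: wspan_scale.
rewrite (bigD1 b) //= fd_dual // eqxx mulr1 big1 ?addr0 ?subrr // => b' /andP[b'B nb].
by rewrite fd_dual // (negPf nb) mulr0.
Qed.

(* The left side is the trace of [f |-> f (g * _ * h^-1)] on [wspan]. *)
Lemma trace_Psi g h : \sum_(b in B) fd b (g * b * h^-1)%g = Psi n F g h.
Proof.
pose K g := \sum_(b in B) fd b (g * b * h^-1)%g.
have KA : wspan K.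
  apply: wspan_sum => b; have [c cE] := wspan_mulr (b * h^-1)%g (fd_span b).
  by exists c => s; rewrite -cE mulgA.
(* Cyclicity of the trace: translation by [s] is expanded in the basis [fd], the order of summation
   is exchanged, and the basis is summed back. *)
have Kclass s g' : K (s * g' * s^-1)%g = K g'.
  transitivity (\sum_(b in B) \sum_(r in B) fd b (s * r)%g * fd r (g' * s^-1 * b * h^-1)%g).
    apply: eq_bigr => b _; rewrite -!mulgA.
    rewrite (wspan_expand (wspan_mull s (fd_span b))).
    by apply: eq_bigr => r _; rewrite !mulgA.
  rewrite exchange_big /=; apply: eq_bigr => r _.
  under eq_bigr do rewrite mulrC.
  have A1 : wspan (fun x => fd r (g' * s^-1 * x * h^-1)%g).
    have [c cE] := wspan_mull (g' * s^-1)%g (wspan_mulr h^-1%g (fd_span r)).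
    by exists c => x; rewrite -cE.
  by rewrite -(wspan_expand A1) mulgA mulgKV.
apply: (@mulIf _ (#|T|)`!%:R); first by rewrite pnatr_eq0 -lt0n fact_gt0.
rewrite -/(K g) mulr_natr -(Psi_classfun KA Kclass).
transitivity (\sum_(b in B) \sum_g' Psi n F g g' * fd b (g' * b * h^-1)%g).
  by rewrite exchange_big /=; apply: eq_bigr => g' _; rewrite mulr_sumr.
(* The substitution [x = g' * b * h^-1] frees the argument of [fd b] of [g'] and [h], so that the
   sum over [b] is again an expansion in the basis, of [Psi] as a function of [b]. *)
transitivity (\sum_x \sum_(b in B) Psi n F g (x * (h * b^-1))%g * fd b x).
  rewrite [RHS]exchange_big /=; apply: eq_bigr => b _.
  rewrite (reindex_inj (mulIg (h * b^-1))%g) /=; apply: eq_bigr => x _.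
  by congr (_ * fd b _); rewrite -!mulgA mulKg mulgV mulg1.
rewrite mulr_natr -card_permT -sumr_const; apply: eq_bigr => x _.
have A2 : wspan (fun b => Psi n F g (x * (h * b^-1))%g).
  have [c cE] := wspan_inv (wspan_mull (x * h)%g (wspan_Psi n F g)).
  by exists c => b; rewrite -cE mulgA.
by rewrite -(wspan_expand A2) /= mulgA Psi_conjr.
Qed.

End Trace.

(** * Dual bases from triangular families *)

Section Dual.
Variables (T : finType) (n : nat) (F : numClosedFieldType).
Variable lt : rel {perm T}.
Hypothesis lt_irr : irreflexive lt.
Hypothesis lt_trans : transitive lt.

Lemma lt_ind (P : {perm T} -> Prop) :
  (forall s, (forall s', lt s' s -> P s') -> P s) -> forall s, P s.
Proof.
move=> IH s; have [k] := ubnP #|[pred s' | lt s' s]|.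
elim: k s => // k IHk s; rewrite ltnS => sk; apply: IH => s' s's; apply: IHk.
apply: leq_trans sk; apply/proper_card/properP; split.
  by apply/subsetP => x; rewrite !inE => /lt_trans; apply.
by exists s'; rewrite !inE ?lt_irr.
Qed.

Lemma gt_ind (P : {perm T} -> Prop) :
  (forall s, (forall s', lt s s' -> P s') -> P s) -> forall s, P s.
Proof.
move=> IH s; have [k] := ubnP #|[pred s' | lt s s']|.
elim: k s => // k IHk s; rewrite ltnS => sk; apply: IH => s' s's; apply: IHk.
apply: leq_trans sk; apply/proper_card/properP; split.
  by apply/subsetP => x; rewrite !inE; apply: lt_trans.
by exists s'; rewrite !inE ?lt_irr.
Qed.

(** Triangular elimination: by induction along [lt], the values of [f] at the smaller elements of
    [B] are cleared by subtracting the dual functions already built. *)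
Lemma dual_basis (B : {pred {perm T}}) :
  (forall b, b \in B -> exists2 f : {perm T} -> F, wspan n f &
     f b = 1 /\ (forall s, f s != 0 -> s = b \/ lt s b)) ->
  exists fd : {perm T} -> {perm T} -> F,
    (forall b, wspan n (fd b)) /\ {in B &, forall b b', fd b b' = (b == b')%:R}.
Proof.
move=> tri.
suff /fin_all_exists[fd fdP] : forall b, exists f : {perm T} -> F,
    wspan n f /\ (b \in B -> {in B, forall b', f b' = (b == b')%:R}).
  by exists fd; split=> [b|b b' bB b'B]; [case: (fdP b) | case: (fdP b) => _ ->].
apply: lt_ind => b IH.
have w0 : @wspan T n F (fun=> 0) by exists (fun _ _ => 0) => s; rewrite big1.
case: (boolP (b \in B)) => bB; last by exists (fun=> 0).
have [f fA [fb fs]] := tri b bB.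
have /fin_all_exists[fd fdP] : forall b', exists f' : {perm T} -> F,
    wspan n f' /\ (b' \in B -> lt b' b -> {in B, forall b'', f' b'' = (b' == b'')%:R}).
  move=> b'; case: (boolP (lt b' b)) => [/IH[f' [? ?]]|_]; last by exists (fun=> 0).
  by exists f'; split=> // b'B _; auto.
exists (fun s => f s - \sum_(b' in B | lt b' b) f b' * fd b' s); split.
  apply: wspan_sub => //; apply: wspan_sum => b'; apply: wspan_scale.
  by case: (fdP b').
move=> _ b'' b''B.
have fdE : \sum_(b' in B | lt b' b) f b' * fd b' b'' = if lt b'' b then f b'' else 0.
  have E b' : (b' \in B) && lt b' b -> f b' * fd b' b'' = if b' == b'' then f b' else 0.
    move=> /andP[b'B l]; have [_ ->] := fdP b' => //.
    by case: eqP; rewrite ?mulr1 ?mulr0.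
  rewrite (eq_bigr _ E) -big_mkcondr /=.
  case: ifP => l; last by rewrite big_pred0 // => b'; apply/negP => /andP[/andP[_ l'] /eqP e]; rewrite -e l' in l.
  rewrite (big_pred1 b'') // => b'; rewrite /= andbC; apply: andb_idr => /eqP ->.
  by rewrite b''B l.
rewrite fdE; case: ifP => l.
  by rewrite subrr; case: eqP l => // ->; rewrite lt_irr.
rewrite subr0; case: eqP => [<-//|nb].
by apply/eqP/negPn/negP => /fs[e|]; [apply: nb|rewrite l].
Qed.

End Dual.

(** * Permutations without long increasing subsequences *)

Section Increasing.
Variables (T : finType) (nu : T -> int) (n : nat) (F : numClosedFieldType).
Hypothesis nu_inj : injective nu.
Hypothesis n_gt0 : (0 < n)%N.
Implicit Types (s : {perm T}) (A : {set T}).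

Definition incr_on s A : bool :=
  [forall x in A, forall y in A, (nu x < nu y) ==> (nu (s x) < nu (s y))].

Lemma incr_onP s A :
  reflect {in A &, forall x y, nu x < nu y -> nu (s x) < nu (s y)} (incr_on s A).
Proof.
apply: (iffP forall_inP) => [H x y xA yA|H x xA].
  by move/forall_inP: (H x xA) => /(_ y yA)/implyP.
by apply/forall_inP => y yA; apply/implyP; apply: H.
Qed.

Definition lis_le : {pred {perm T}} :=
  [pred s | [forall A : {set T}, incr_on s A ==> (#|A| <= n)%N]].

Definition lexlt s s' : bool :=
  [exists x, (nu (s x) < nu (s' x)) && [forall y, (nu y < nu x) ==> (s y == s' y)]].

Lemma lexltP s s' :
  reflect (exists2 x, nu (s x) < nu (s' x) & forall y, nu y < nu x -> s y = s' y) (lexlt s s').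
Proof.
apply: (iffP existsP) => [[x /andP[lt /forallP H]]|[x lt H]]; exists x => //.
  by move=> y yx; apply/eqP; move/implyP: (H y); apply.
by rewrite lt; apply/forallP => y; apply/implyP => /H ->.
Qed.

Lemma lexlt_irr : irreflexive lexlt.
Proof. by move=> s; apply/lexltP => -[x]; rewrite ltxx. Qed.

Lemma lexlt_trans : transitive lexlt.
Proof.
move=> s2 s1 s3 /lexltP[x lx Hx] /lexltP[y ly Hy]; apply/lexltP.
have [xy|yx|/nu_inj exy] := ltgtP (nu x) (nu y).
- exists x => [|z zx]; first by rewrite -(Hy x xy).
  by rewrite Hx // Hy // (lt_trans zx).
- exists y => [|z zy]; first by rewrite (Hx y yx).
  by rewrite Hx ?Hy // (lt_trans zy).
- subst y; exists x => [|z zx]; first exact: lt_trans ly.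
  by rewrite Hx ?Hy.
Qed.

Lemma first_diff s s' : s != s' ->
  exists2 x, s x != s' x & forall y, nu y < nu x -> s y = s' y.
Proof.
move=> ne; have [x0 x0P] : exists x, s x != s' x.
  apply/existsP; rewrite -negb_forall; apply: contra ne => /forallP e.
  by apply/eqP/permP => x; apply/eqP.
case: (@Order.TotalTheory.arg_minP _ _ _ x0 (fun x => s x != s' x) nu x0P) => x xP xmin.
exists x => // y yx; apply/eqP; apply: contraTT yx => /xmin.
by rewrite leNgt.
Qed.

(* An increasing pattern is the lexicographically smallest among its rearrangements. *)
Lemma lexlt_incr s (r : {perm T}) A :
  incr_on s A -> perm_on A r -> r != 1%g -> lexlt s (r * s)%g.
Proof.
move=> /incr_onP sA rA /first_diff[x rx Hx]; rewrite perm1 in rx.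
have Hy y : nu y < nu x -> r y = y by move/Hx; rewrite perm1.
have xA : x \in A by apply: (subsetP rA); rewrite inE.
apply/lexltP; exists x => [|y yx]; last by rewrite permM Hy.
rewrite permM; apply: sA => //; first by rewrite perm_closed.
rewrite lt_neqAle (inj_eq nu_inj) eq_sym rx leNgt; apply/negP => /Hy/perm_inj e.
by rewrite e eqxx in rx.
Qed.

(** By the pigeonhole principle the word [u o s] repeats a letter on [A]; exchanging the two
    positions leaves the matrix coefficient unchanged and reverses the sign. *)
Lemma antisym_wspan (f : {perm T} -> F) s A : wspan n f -> (n < #|A|)%N ->
  \sum_(r : {perm T} | perm_on A r) (-1) ^+ r * f (r * s)%g = 0.
Proof.
move=> [c fE] nA.
under eq_bigr do rewrite fE mulr_sumr.
rewrite exchange_big big1 //= => u _.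
have [x [y [xA yA xy uxy]]] : exists x y, [/\ x \in A, y \in A, x != y & u (s x) = u (s y)].
  have : ~~ [forall x in A, forall y in A, (u (s x) == u (s y)) ==> (x == y)].
    apply: contraL nA => /forall_inP H; rewrite -leqNgt.
    rewrite -[X in (_ <= X)%N]card_ord -(card_in_imset (f := u \o s)) ?max_card // => x y xA yA /= e.
    by apply/eqP; have /forall_inP/(_ y yA)/implyP := H x xA; apply; rewrite e.
  rewrite negb_forall => /existsP[x]; rewrite negb_imply => /andP[xA].
  rewrite negb_forall => /existsP[y]; rewrite negb_imply => /andP[yA].
  by rewrite negb_imply => /andP[/eqP e xy]; exists x, y.
set S := \sum_(i | _) _; apply/eqP; rewrite -[S == 0](mulrn_eq0 S 2) mulr2n.
rewrite {1}/S (reindex_inj (mulIg (tperm x y))) /= (eq_bigl (perm_on A)) => [|r]; last first.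
  have tA : perm_on A (tperm x y).
    by apply: subset_trans (tperm_on x y) _; apply/subsetP => z /set2P[]->.
  apply/idP/idP => rA; last exact: perm_onM.
  by rewrite -[r]mulg1 -(tperm2 x y) mulgA perm_onM.
apply/eqP; rewrite -big_split /= big1 // => r rA.
have -> : wact u (r * tperm x y * s)%g = wact u (r * s)%g.
  apply/ffunP=> z; rewrite !ffunE !permM.
  by case: tpermP => [->|->|].
by rewrite odd_permM odd_tperm xy addbT signrN mulNr addNr.
Qed.

(** If [s] is increasing on a set [A] of more than [n] points, [antisym_wspan] expresses [f s]
    through values at rearrangements of [s] on [A], all lexicographically larger by [lexlt_incr].
    Hence an induction from the top of the order. *)
Lemma lis_le_sep (f : {perm T} -> F) : wspan n f ->
  {in lis_le, forall s, f s = 0} -> forall s, f s = 0.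
Proof.
move=> fA f0; apply: (gt_ind lexlt_irr lexlt_trans) => s IH.
case: (boolP (s \in lis_le)) => [/f0//|].
rewrite inE negb_forall => /existsP[A]; rewrite negb_imply -ltnNge => /andP[sA nA].
have := antisym_wspan s fA nA; rewrite (bigD1 1%g) /=; last first.
  by apply/subsetP => x; rewrite inE perm1 eqxx.
rewrite odd_perm1 mul1r mul1g big1 ?addr0 // => r /andP[rA r1].
by rewrite IH ?mulr0 // (lexlt_incr sA rA).
Qed.

Definition chain_len s x : nat :=
  \max_(A : {set T} | [&& incr_on s A, x \in A & [forall y in A, nu y <= nu x]]) #|A|.

Lemma chain_len_gt0 s x : (0 < chain_len s x)%N.
Proof.
apply: (bigop.bigmax_sup [set x]); rewrite ?cards1 // inE eqxx andTb; apply/andP; split.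
  by apply/incr_onP => y z /set1P-> /set1P->; rewrite ltxx.
by apply/forall_inP => y /set1P->.
Qed.

Lemma chain_len_le s x : s \in lis_le -> (chain_len s x <= n)%N.
Proof.
move=> /forallP sB; apply/bigop.bigmax_leqP => A /and3P[sA _ _].
by move/implyP: (sB A); apply.
Qed.

Lemma chain_len_lt s x y : nu x < nu y -> nu (s x) < nu (s y) ->
  (chain_len s x < chain_len s y)%N.
Proof.
move=> xy sxy.
have [A /and3P[/incr_onP sA xA /forall_inP Ax] ->] :
    {A | [&& incr_on s A, x \in A & [forall y in A, nu y <= nu x]] & chain_len s x = #|A|}.
  apply: bigop.eq_bigmax_cond; apply/card_gt0P; exists [set x].
  rewrite unfold_in set11 andTb; apply/andP; split.
    by apply/incr_onP => z t /set1P-> /set1P->; rewrite ltxx.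
  by apply/forall_inP => z /set1P->.
have yA : y \notin A by apply/negP => /Ax; rewrite leNgt xy.
apply: (bigop.bigmax_sup (y |: A)); rewrite ?cardsU1 ?yA //; apply/and3P; split.
- apply/incr_onP => z t /setU1P[->|zA] /setU1P[->|tA]; rewrite ?ltxx //.
  + by move=> yt; have := lt_le_trans yt (Ax t tA); rewrite lt_gtF.
  + move=> _; move: (Ax z zA); rewrite le_eqVlt => /predU1P[/nu_inj -> //|zx].
    exact: lt_trans (sA _ _ zA xA zx) sxy.
  + exact: sA.
- by rewrite setU11.
by apply/forall_inP => z /setU1P[->//|/Ax zx]; rewrite (le_trans zx) // ltW.
Qed.

(** The function tests whether [s] sends every colour class of positions to the same set of values
    as [b]. On positions of equal colour [b] decreases, so among all such [s] the lexicographically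
    largest is [b]. *)
Lemma lis_le_tri b : b \in lis_le ->
  exists2 f : {perm T} -> F, wspan n f &
    f b = 1 /\ (forall s, f s != 0 -> s = b \/ lexlt s b).
Proof.
(* Colours start at 0; the default of [insubd] is never reached, since [chain_len b x] lies between
   1 and [n]. *)
move=> bB; pose c : {ffun T -> 'I_n} := [ffun x => insubd (Ordinal n_gt0) (chain_len b x).-1].
have cE x : c x = (chain_len b x).-1 :> nat.
  by rewrite ffunE val_insubd ifT // prednK ?chain_len_gt0 ?chain_len_le.
have c_decr x y : nu x < nu y -> c x = c y -> nu (b y) < nu (b x).
  move=> xy /(congr1 val); rewrite /= !cE => e; rewrite lt_neqAle (inj_eq nu_inj) (inj_eq perm_inj).
  apply/andP; split; first by apply: contraTneq xy => ->; rewrite ltxx.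
  rewrite leNgt; apply/negP => bxy; have := chain_len_lt xy bxy.
  have := chain_len_gt0 b x; have := chain_len_gt0 b y; lia.
pose u : {ffun T -> 'I_n} := wact c b^-1%g.
exists (fun s => (wact u s == c)%:R).
  exists (fun u' v' => ((u' == u) && (v' == c))%:R) => s.
  by rewrite (bigD1 u) //= eqxx big1 ?addr0 // => u' /negPf ->.
split=> [|s]; first by rewrite wactM mulgV wact1 eqxx.
case: (wact u s =P c) => [e _|_]; last by rewrite eqxx.
have [->|/first_diff[x sx Hx]] := eqVneq s b; [by left|right].
(* Here [x] is the first place where [s] and [b] differ and [z] the place where [b] takes the value
   [s x]. Both have the same colour and [z] cannot come before [x], so [b] is smaller at [z] than at
   [x]. *)
apply/lexltP; exists x => //; pose z := (b^-1)%g (s x).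
have bz : b z = s x by rewrite permKV.
have cz : c z = c x.
  by have /ffunP/(_ x) := e; rewrite !ffunE.
have zx : z != x by apply: contraNneq sx => zx; rewrite -bz zx.
have [lt|lt|/nu_inj e'] := ltgtP (nu z) (nu x); last by rewrite e' eqxx in zx.
  by have := Hx z lt; rewrite bz => /perm_inj e'; rewrite e' eqxx in zx.
by rewrite -bz c_decr.
Qed.

(** Conjugation by [w] maps [lis_le] to itself, so by duality [fd s] at the conjugate of [s] is 1 or
    0 according to whether [s] is fixed; [trace_Psi] with [g = h = w] sums these values. *)
Theorem card_conj_fixed (w : {perm T}) :
  (forall s, s \in lis_le -> (w * s * w^-1)%g \in lis_le) ->
  #|[set s in lis_le | (w * s * w^-1)%g == s]|%:R = Psi n F w w.
Proof.
move=> wB; have [fd [fdA fdd]] := dual_basis lexlt_irr lexlt_trans lis_le_tri.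
rewrite -(trace_Psi n_gt0 fdA fdd lis_le_sep) -sum1_card natr_sum big_mkcond /=.
rewrite [RHS]big_mkcond; apply: eq_bigr => s _; rewrite inE.
case: (boolP (s \in lis_le)) => //= sB; rewrite fdd ?wB // eq_sym.
by case: eqP.
Qed.

End Increasing.

(** * Coefficients of Toeplitz determinants *)

Section Multinomial.
Variables (I : finType) (F : numFieldType).
Implicit Types (Phi : {ffun I -> nat} -> F).

Definition bump (a : I) (m : {ffun I -> nat}) : {ffun I -> nat} :=
  [ffun i => (m i + (i == a))%N].

Lemma sum_words_recl k Phi :
  \sum_(u : {ffun 'I_k.+1 -> I}) Phi (wt u) =
  \sum_a \sum_(u : {ffun 'I_k -> I}) Phi (bump a (wt u)).
Proof.
rewrite pair_bigA /=.
pose f (p : I * {ffun 'I_k -> I}) : {ffun 'I_k.+1 -> I} :=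
  [ffun x => if unlift ord0 x is Some j then p.2 j else p.1].
pose f' (u : {ffun 'I_k.+1 -> I}) : I * {ffun 'I_k -> I} :=
  (u ord0, [ffun j => u (lift ord0 j)]).
rewrite (reindex f) /=; last first.
  exists f' => [[a u] _|u _].
    rewrite /f /f' !ffunE unlift_none; congr (_, _).
    by apply/ffunP=> j; rewrite !ffunE liftK.
  by apply/ffunP=> x; rewrite !ffunE /=; case: unliftP => [j|] ->; rewrite ?ffunE.
apply: eq_bigr => -[a u] _; congr Phi; apply/ffunP=> i; rewrite !ffunE big_ord_recl.
rewrite ffunE unlift_none addnC eq_sym; congr (_ + _)%N.
by apply: eq_bigr => j _; rewrite ffunE liftK.
Qed.

Definition invfact M (m : {ffun I -> 'I_M.+1}) : F := (\prod_i ((m i)`!)%:R)^-1.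

(** The factor [m a] lowers the factorial of [m a]; it also kills the compositions with [m a = 0],
    so the others can be shifted down at [a]. *)
Lemma sum_comps_bump M d a Phi : (d < M)%N ->
  \sum_(m in comps I d.+1 M) (m a)%:R * (invfact m * Phi [ffun i => m i : nat]) =
  \sum_(m in comps I d M) invfact m * Phi (bump a [ffun i => m i : nat]).
Proof.
move=> dM.
pose h (m : {ffun I -> 'I_M.+1}) : {ffun I -> 'I_M.+1} := [ffun i => inord (m i + (i == a))].
pose h' (m : {ffun I -> 'I_M.+1}) : {ffun I -> 'I_M.+1} := [ffun i => inord (m i - (i == a))].
have comp_le e (m : {ffun I -> 'I_M.+1}) i : m \in comps I e M -> (m i <= e)%N.
  by rewrite inE => /eqP <-; rewrite (bigD1 i) //= leq_addr.
rewrite (bigID (fun m : {ffun I -> 'I_M.+1} => 0 < m a)%N) /= [X in _ + X]big1 ?addr0; last first.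
  by move=> m /andP[_]; rewrite -eqn0Ngt => /eqP ->; rewrite mul0r.
rewrite (reindex_onto h h') /=; last first.
  move=> m /andP[_ ma]; apply/ffunP=> i; apply: val_inj; rewrite !ffunE /=.
  have le1 : (m i - (i == a) <= M)%N by have := ltn_ord (m i); lia.
  rewrite (inordK (m := m i - _)%N) // subnK ?inordK //.
  by case: eqP => [->|].
have hE (m : {ffun I -> 'I_M.+1}) i : m \in comps I d M -> h m i = (m i + (i == a))%N :> nat.
  move=> mc; rewrite ffunE inordK //; have := comp_le _ _ i mc; case: (i == a); lia.
have sum_h (m : I -> nat) : (\sum_i (m i + (i == a)) = (\sum_i m i).+1)%N.
  rewrite big_split /= -addn1; congr (_ + _)%N.
  by rewrite (bigD1 a) //= eqxx big1 // => i /negPf ->.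
have h_comps (m : {ffun I -> 'I_M.+1}) : (forall i, h m i = (m i + (i == a))%N :> nat) ->
    (h m \in comps I d.+1 M) = (m \in comps I d M).
  by move=> hm; rewrite !inE; under eq_bigr do rewrite hm; rewrite sum_h eqSS.
have hm_of (m : {ffun I -> 'I_M.+1}) : h' (h m) = m -> (0 < h m a)%N ->
    forall i, h m i = (m i + (i == a))%N :> nat.
  move=> hh ha i; have /= := congr1 (fun u : {ffun I -> 'I_M.+1} => val (u i)) hh.
  rewrite {1}/h' ffunE inordK; last by have := ltn_ord (h m i); lia.
  by move=> <-; case: eqP => [->|]; rewrite ?subn0 ?addn0 ?subnK.
apply: eq_big => [m|m /andP[/andP[hc ha] /eqP hh]].
  apply/andP/idP => [[/andP[hc ha] /eqP hh]|mc].
    rewrite -h_comps // => i.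
    exact: hm_of hh ha i.
  have hm i := hE m i mc.
  rewrite h_comps // mc hm eqxx addn1; split=> //.
  apply/eqP/ffunP=> i; apply: val_inj => /=; rewrite /h' ffunE hm addnK inordK //.
have hm i : h m i = (m i + (i == a))%N :> nat.
  exact: hm_of hh ha i.
rewrite mulrA; congr (_ * Phi _); last by apply/ffunP=> i; rewrite ffunE hm !ffunE.
rewrite /invfact (bigD1 a) //= [in RHS](bigD1 a) //= hm eqxx addn1 factS natrM !invfM.
rewrite !mulrA divff ?mul1r ?pnatr_eq0 //; congr (_ * _^-1).
by apply: eq_bigr => i /negPf ia; rewrite hm ia addn0.
Qed.

(** The number of words with content [m] is a multinomial coefficient. The induction splits off the
    first letter [a], and summing [m a] over [a] supplies the factor [k.+1]. *)
Lemma multinomial_sum k M Phi : (k <= M)%N ->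
  \sum_(u : {ffun 'I_k -> I}) Phi (wt u) =
  \sum_(m in comps I k M) (k`!)%:R * (invfact m * Phi [ffun i => m i : nat]).
Proof.
elim: k Phi => [|k IH] Phi kM.
  pose m0 : {ffun I -> 'I_M.+1} := [ffun=> ord0].
  rewrite (big_pred1 m0) => [|m]; last first.
    rewrite inE sum_nat_eq0; apply/forallP/eqP => [H|->] /=; last by move=> i; rewrite ffunE.
    by apply/ffunP=> i; apply: val_inj; rewrite ffunE; apply/eqP/H.
  have wt0 (u : {ffun 'I_0 -> I}) : wt u = [ffun i => m0 i : nat].
    by apply/ffunP=> i; rewrite !ffunE big_ord0.
  rewrite (eq_bigr (fun=> Phi [ffun i => m0 i : nat])) => [|u _]; last by rewrite wt0.
  rewrite sumr_const card_ffun card_ord expn0 mulr1n fact0 mul1r /invfact big1 ?invr1 ?mul1r //.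
  by move=> i _; rewrite ffunE.
rewrite sum_words_recl.
transitivity (\sum_a \sum_(m in comps I k.+1 M)
    (k`!)%:R * ((m a)%:R * (invfact m * Phi [ffun i => m i : nat]))).
  apply: eq_bigr => a _; rewrite (IH (fun m => Phi (bump a m))) ?(ltnW kM) //.
  by rewrite -!mulr_sumr sum_comps_bump.
rewrite exchange_big /=; apply: eq_bigr => m; rewrite inE => /eqP sm.
rewrite factS natrM mulrC mulrA -mulrA -mulr_sumr -mulr_suml -natr_sum sm.
by rewrite mulrCA mulrA.
Qed.

End Multinomial.

Section DetCoef.
Variables (F : numFieldType) (n : nat).

(* For [c = 1] this is a truncation of the power series of the Fourier coefficient of
   index [a - b] of [exp (X (z + 1/z))], and for [c = 2] of [exp (X (z ^ 2 + 1 / z ^ 2))]. *)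
Definition gpoly (c M a b : nat) : {poly F} :=
  \sum_(p < M.+1) \sum_(q < M.+1)
    if (c * p + a == c * q + b)%N then ((p`!)%:R * (q`!)%:R)^-1 *: 'X^(p + q) else 0.

Lemma coef_prod_gpoly c M (a b : 'I_n -> nat) d :
  (\prod_i gpoly c M (a i) (b i))`_d =
  \sum_(m : {ffun 'I_n -> 'I_M.+1}) \sum_(l : {ffun 'I_n -> 'I_M.+1})
    ([forall i, c * m i + a i == c * l i + b i] && (\sum_i m i + \sum_i l i == d))%N%:R *
    (invfact F m * invfact F l).
Proof.
rewrite /gpoly bigA_distr_bigA coef_sum; apply: eq_bigr => m _.
rewrite bigA_distr_bigA coef_sum; apply: eq_bigr => l _ /=.
case: forallP => [H|/forallP]; last first.
  rewrite negb_forall => /existsP[i ni].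
  by rewrite (bigD1 i) //= (negPf ni) mul0r coef0 mul0r.
rewrite (eq_bigr (fun i => ((m i)`!%:R * (l i)`!%:R)^-1 *: 'X^(m i + l i))) => [|i _]; last first.
  by rewrite H.
rewrite scaler_prod prodrXr big_split coefZ coefXn /= eq_sym mulrC; congr (_ * _).
by rewrite /invfact -invfM -big_split prodfV.
Qed.

(** Summed over [i], the equations lose [a] and [b]. In a coefficient of degree [2 * k] this forces
    both sums of exponents to be [k]. *)
Lemma balanced c M (a b : 'I_n -> nat) (s : 'S_n) (m l : {ffun 'I_n -> 'I_M.+1}) :
  (0 < c)%N -> (\sum_i a i = \sum_i b i)%N ->
  (forall i, c * m i + a i == c * l i + b (s i))%N -> (\sum_i m i = \sum_i l i)%N.
Proof.
move=> c0 sab H; apply/eqP; rewrite -(eqn_pmul2l c0) -(eqn_add2r (\sum_i a i)).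
rewrite [X in (_ == _ + X)%N]sab [X in (_ == _ + X)%N](reindex_inj (@perm_inj _ s)) /=.
by rewrite !big_distrr -!big_split /=; apply/eqP/eq_bigr => i _; apply/eqP.
Qed.

Lemma coef_det_gpoly_odd c M (a b : 'I_n -> nat) d : (0 < c)%N ->
  (\sum_i a i = \sum_i b i)%N -> odd d ->
  (\det (\matrix_(i, l) gpoly c M (a i) (b l)))`_d = 0.
Proof.
move=> c0 sab od; rewrite coef_sum big1 // => s _.
rewrite -signr_odd mulr_sign; under eq_bigr do rewrite mxE.
have E : (\prod_i gpoly c M (a i) (b (s i)))`_d = 0.
  rewrite coef_prod_gpoly big1 // => m _; rewrite big1 // => l _.
  case: forallP => [H|]; last by rewrite mul0r.
  case: eqP => [e|]; last by rewrite mul0r.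
  by move: od; rewrite -e (balanced c0 sab H) addnn odd_double.
by case: ifP; rewrite ?coefN E ?oppr0.
Qed.

(** In degree [2 * k] only pairs of exponent vectors of sum [k] each contribute, by [balanced]; the
    weights [invfact] then count words through [multinomial_sum]. *)
Lemma coef_det_gpoly c M (a b : 'I_n -> nat) k : (0 < c)%N -> (k <= M)%N ->
  (\sum_i a i = \sum_i b i)%N ->
  (k`!)%:R ^+ 2 * (\det (\matrix_(i, l) gpoly c M (a i) (b l)))`_(2 * k) =
  \sum_(s : 'S_n) (-1) ^+ s *
    \sum_(u : {ffun 'I_k -> 'I_n}) \sum_(v : {ffun 'I_k -> 'I_n})
      [forall i, c * wt u i + a i == c * wt v i + b (s i)]%N%:R.
Proof.
move=> c0 kM sab; rewrite coef_sum mulr_sumr; apply: eq_bigr => s _.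
under eq_bigr do rewrite mxE.
have -> : ((-1) ^+ s * \prod_i gpoly c M (a i) (b (s i)))`_(2 * k) =
          (-1) ^+ s * (\prod_i gpoly c M (a i) (b (s i)))`_(2 * k).
  by rewrite !mulr_sign; case: ifP; rewrite ?coefN.
rewrite mulrCA; congr (_ * _); rewrite coef_prod_gpoly.
transitivity (\sum_(m in comps 'I_n k M) (k`!)%:R * (invfact F m *
   \sum_(l in comps 'I_n k M) (k`!)%:R * (invfact F l *
     [forall i, c * m i + a i == c * l i + b (s i)]%N%:R))); last first.
  pose Phi (m : {ffun 'I_n -> nat}) : F := \sum_(v : {ffun 'I_k -> 'I_n})
      [forall i, c * m i + a i == c * wt v i + b (s i)]%N%:R.
  rewrite [RHS](multinomial_sum Phi kM); apply: eq_bigr => m _; congr (_ * (_ * _)).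
  pose Psi (l : {ffun 'I_n -> nat}) : F := [forall i, c * m i + a i == c * l i + b (s i)]%N%:R.
  transitivity (\sum_(v : {ffun 'I_k -> 'I_n}) Psi (wt v)); last first.
    by rewrite /Phi /Psi; apply: eq_bigr => v _; congr (nat_of_bool _)%:R; apply: eq_forallb => i; rewrite !ffunE.
  rewrite (multinomial_sum Psi kM); apply: eq_bigr => l _; congr (_ * (_ * _)).
  by rewrite /Psi; congr (nat_of_bool _)%:R; apply: eq_forallb => i; rewrite ffunE.
rewrite mulr_sumr [RHS]big_mkcond; apply: eq_bigr => m _.
have key (l : {ffun 'I_n -> 'I_M.+1}) : (k`!)%:R ^+ 2 *
    (([forall i, c * m i + a i == c * l i + b (s i)] && (\sum_i m i + \sum_i l i == 2 * k))%N%:R *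
     (invfact F m * invfact F l)) =
    if m \in comps 'I_n k M then
      if l \in comps 'I_n k M then (k`!)%:R * (invfact F m * ((k`!)%:R * (invfact F l *
        [forall i, c * m i + a i == c * l i + b (s i)]%N%:R))) else 0 else 0.
  rewrite !inE; case: forallP => [H|_]; last by rewrite !mul0r !mulr0 !if_same.
  have e := balanced c0 sab H; rewrite -e addnn -mul2n eqn_pmul2l // mulr1.
  by case: eqP => _; rewrite ?mul0r ?mulr0 // mul1r expr2 -!mulrA; congr (_ * _); rewrite mulrCA.
rewrite [LHS]mulr_sumr; under [LHS]eq_bigr do rewrite key.
case: ifP => mc; last by rewrite big1.
by rewrite -big_mkcond -!mulr_sumr.
Qed.
End DetCoef.

(** * Odd permutations *)

Section FixedWords.
Variables (T P Z : finType) (n : nat) (w : {perm T}) (e : (P + P) + Z -> T).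
Hypothesis e_bij : bijective e.
Hypothesis w_l : forall j, w (e (inl (inl j))) = e (inl (inr j)).
Hypothesis w_r : forall j, w (e (inl (inr j))) = e (inl (inl j)).
Hypothesis w_z : forall z, w (e (inr z)) = e (inr z).

(** The map [e] lays out [w] as an involution swapping two copies of [P] and fixing [Z] pointwise. A
    fixed word is thus free on one copy of [P] and on [Z], and its letters on [P] count twice. *)
Lemma sum_fixed_words (V : nmodType) (Phi : {ffun 'I_n -> nat} -> V) :
  \sum_(u : {ffun T -> 'I_n} | wact u w == u) Phi (wt u) =
  \sum_(p : {ffun P -> 'I_n}) \sum_(q : {ffun Z -> 'I_n})
     Phi [ffun i => (2 * wt p i + wt q i)%N].
Proof.
rewrite pair_bigA /=; have [e' eK e'K] := e_bij.
pose f (pq : {ffun P -> 'I_n} * {ffun Z -> 'I_n}) : {ffun T -> 'I_n} :=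
  [ffun x => match e' x with inl (inl j) | inl (inr j) => pq.1 j | inr z => pq.2 z end].
pose f' (u : {ffun T -> 'I_n}) : {ffun P -> 'I_n} * {ffun Z -> 'I_n} :=
  ([ffun j => u (e (inl (inl j)))], [ffun z => u (e (inr z))]).
rewrite (reindex f) /=; last first.
  exists f' => [[p q] _|u].
    by congr (_, _); apply/ffunP=> x; rewrite !ffunE eK.
  rewrite inE => /eqP/ffunP fu; apply/ffunP=> x; rewrite ffunE -[in RHS](e'K x).
  case: (e' x) => [[j|j]|z]; rewrite ffunE //=.
  by have := fu (e (inl (inl j))); rewrite ffunE w_l => ->.
apply: eq_big => [[p q]|[p q] _] /=.
  apply/eqP/ffunP => x; rewrite !ffunE -(e'K x).
  by case: (e' x) => [[j|j]|z]; rewrite ?w_l ?w_r ?w_z !eK.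
congr Phi; apply/ffunP=> i; rewrite !ffunE (reindex e) /=; last exact: onW_bij.
rewrite !big_sumType /= mul2n -addnn.
by congr (_ + _ + _)%N; apply: eq_bigr => x _; rewrite ffunE eK.
Qed.

End FixedWords.

(** * [Psi] at an involution as a coefficient of a determinant *)

Section PsiCoef.
Variables (T : finType) (n k : nat) (F : numFieldType) (w : {perm T}) (M : nat).
Hypothesis kM : (k <= M)%N.

Lemma Psi_words_even (e : ('I_k + 'I_k) + 'I_0 -> T) : bijective e ->
  (forall j, w (e (inl (inl j))) = e (inl (inr j))) ->
  (forall j, w (e (inl (inr j))) = e (inl (inl j))) ->
  Psi n F w w = (k`!)%:R ^+ 2 *
    (\det (\matrix_(i < n, l < n) gpoly F 2 M i l))`_(2 * k).
Proof.
move=> e_bij w_l w_r.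
have w_z (z : 'I_0) : w (e (inr z)) = e (inr z) by case: z.
have fixE := sum_fixed_words e_bij w_l w_r w_z.
have words0 (Phi : {ffun 'I_n -> nat} -> F) :
    \sum_(u : {ffun T -> 'I_n} | wact u w == u) Phi (wt u) =
    \sum_(p : {ffun 'I_k -> 'I_n}) Phi [ffun i => (2 * wt p i)%N].
  rewrite fixE; apply: eq_bigr => p _.
  have E (q : {ffun 'I_0 -> 'I_n}) : [ffun i => (2 * wt p i + wt q i)%N] = [ffun i => (2 * wt p i)%N].
    by apply/ffunP => i; rewrite !ffunE big_ord0 addn0.
  by under eq_bigr do rewrite E; rewrite sumr_const card_ffun !card_ord expn0.
rewrite coef_det_gpoly //; apply: eq_bigr => s _; congr (_ * _).
pose Phi (m : {ffun 'I_n -> nat}) : F := \sum_(v : {ffun T -> 'I_n} | wact v w == v)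
   [forall i, m i + i == wt v i + s i]%N%:R.
rewrite [LHS](words0 Phi); apply: eq_bigr => p _.
pose Phi' (m : {ffun 'I_n -> nat}) : F := [forall i, 2 * wt p i + i == m i + s i]%N%:R.
transitivity (\sum_(v : {ffun T -> 'I_n} | wact v w == v) Phi' (wt v)).
  by apply: eq_bigr => v _; rewrite /Phi'; congr (nat_of_bool _)%:R; apply: eq_forallb => i; rewrite !ffunE.
rewrite words0; apply: eq_bigr => q _.
by rewrite /Phi'; congr (nat_of_bool _)%:R; apply: eq_forallb => i; rewrite !ffunE.
Qed.

(* The letters [a], [b] at the fixed point shift a row and a column index by one; unless it is
   the last one, the shifted row or column then coincides with the next one. *)
Lemma Psi_words_odd (e : ('I_k + 'I_k) + 'I_1 -> T) : (0 < n)%N -> bijective e ->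
  (forall j, w (e (inl (inl j))) = e (inl (inr j))) ->
  (forall j, w (e (inl (inr j))) = e (inl (inl j))) ->
  (forall z, w (e (inr z)) = e (inr z)) ->
  Psi n F w w = (k`!)%:R ^+ 2 *
    (\det (\matrix_(i < n, l < n) gpoly F 2 M (i + (i == n.-1 :> nat)) (l + (l == n.-1 :> nat))))`_(2 * k).
Proof.
move=> n0 e_bij w_l w_r w_z.
have fixE := sum_fixed_words e_bij w_l w_r w_z.
have words1 (Phi : {ffun 'I_n -> nat} -> F) :
    \sum_(u : {ffun T -> 'I_n} | wact u w == u) Phi (wt u) =
    \sum_a \sum_(p : {ffun 'I_k -> 'I_n}) Phi [ffun i => (2 * wt p i + (i == a))%N].
  rewrite fixE [RHS]exchange_big /=; apply: eq_bigr => p _.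
  pose G (m : {ffun 'I_n -> nat}) := Phi [ffun i => (2 * wt p i + m i)%N].
  transitivity (\sum_(q : {ffun 'I_1 -> 'I_n}) G (wt q)); first by [].
  rewrite sum_words_recl; apply: eq_bigr => a _.
  rewrite (eq_bigr (fun=> Phi [ffun i => (2 * wt p i + (i == a))%N])) => [|q _].
    by rewrite sumr_const card_ffun !card_ord expn0.
  by congr Phi; apply/ffunP=> i; rewrite !ffunE big_ord0.
pose D (a b : 'I_n) : {poly F} :=
  \det (\matrix_(i < n, l < n) gpoly F 2 M (i + (i == a)) (l + (l == b))).
transitivity (\sum_a \sum_b (k`!)%:R ^+ 2 * (D a b)`_(2 * k)).
  have sumE (a b : 'I_n) : (\sum_(i < n) (i + (i == a)) = \sum_(i < n) (i + (i == b)))%N.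
    rewrite !big_split /=; congr (_ + _)%N.
    have one (c : 'I_n) : (\sum_(i < n) (i == c) = 1)%N.
      by rewrite (bigD1 c) //= eqxx big1 // => i /negPf ->.
    by rewrite !one.
  under [RHS]eq_bigr do under eq_bigr => b _ do rewrite (coef_det_gpoly _ _ _ (sumE _ b)) //.
  under [RHS]eq_bigr do rewrite exchange_big /=.
  rewrite [RHS]exchange_big /=; apply: eq_bigr => s _.
  under [RHS]eq_bigr do rewrite -mulr_sumr.
  rewrite -mulr_sumr; congr (_ * _).
  pose Phi (m : {ffun 'I_n -> nat}) : F := \sum_(v : {ffun T -> 'I_n} | wact v w == v)
     [forall i, m i + i == wt v i + s i]%N%:R.
  rewrite [LHS](words1 Phi); apply: eq_bigr => a _.
  rewrite [RHS]exchange_big /=; apply: eq_bigr => p _.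
  pose Phi' (m : {ffun 'I_n -> nat}) : F :=
    [forall i, 2 * wt p i + (i == a) + i == m i + s i]%N%:R.
  transitivity (\sum_(v : {ffun T -> 'I_n} | wact v w == v) Phi' (wt v)).
    by apply: eq_bigr => v _; rewrite /Phi'; congr (nat_of_bool _)%:R; apply: eq_forallb => i; rewrite !ffunE.
  (* Reindexing the letter [b] at the fixed point of the second word by [s] turns its shift into one
     of the column index [s i]. *)
  rewrite words1 (reindex_inj (@perm_inj _ s^-1)) /=.
  apply: eq_bigr => b _; apply: eq_bigr => q _.
  rewrite /Phi'; congr (nat_of_bool _)%:R; apply: eq_forallb => i; rewrite !ffunE.
  by rewrite -!addnA [((i == a) + i)%N]addnC [(_ + s i)%N]addnC [i == s^-1%g b]eq_sym (canF_eq (permKV s)) [b == s i]eq_sym.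
have D_row (a b : 'I_n) : (a < n.-1)%N -> D a b = 0.
  move=> an; have a1n : (a.+1 < n)%N by lia.
  apply: (determinant_alternate (i1 := a) (i2 := Ordinal a1n)).
    by rewrite -val_eqE /= neq_ltn ltnSn.
  move=> l; rewrite !mxE -!val_eqE /= eqxx addn1.
  by rewrite (gtn_eqF (ltnSn a)) /= addn0.
have D_col (a b : 'I_n) : (b < n.-1)%N -> D a b = 0.
  move=> bn; have b1n : (b.+1 < n)%N by lia.
  rewrite /D -det_tr; apply: (determinant_alternate (i1 := b) (i2 := Ordinal b1n)).
    by rewrite -val_eqE /= neq_ltn ltnSn.
  move=> l; rewrite !mxE -!val_eqE /= eqxx addn1.
  by rewrite (gtn_eqF (ltnSn b)) /= addn0.
have nn : (n.-1 < n)%N by lia.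
have last_lt (a : 'I_n) : a != Ordinal nn -> (a < n.-1)%N.
  by rewrite -val_eqE /=; have := ltn_ord a; lia.
rewrite (bigD1 (Ordinal nn)) //= [X in _ + X]big1 ?addr0 => [|a /last_lt an].
  rewrite (bigD1 (Ordinal nn)) //= [X in _ + X]big1 ?addr0 => [|b /last_lt bn].
    suff -> : D (Ordinal nn) (Ordinal nn) = \det (\matrix_(i < n, l < n)
      gpoly F 2 M (i + (i == n.-1 :> nat)) (l + (l == n.-1 :> nat))) by [].
    by congr (\det _); apply/matrixP => i l; rewrite !mxE -!val_eqE.
  by rewrite D_col // coef0 mulr0.
by rewrite big1 // => b _; rewrite D_row // coef0 mulr0.
Qed.

End PsiCoef.

(** * Separating even from odd indices *)

Section ParitySplit.

(** Rows and columns undergo the same permutation, so the signs cancel. *)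
Lemma det_reindex (R : comNzRingType) (G : nat -> nat -> R) n (a b : 'I_n -> nat) :
  injective b -> (forall i, exists j, a j = b i) ->
  \det (\matrix_(i, l) G (a i) (a l)) = \det (\matrix_(i, l) G (b i) (b l)).
Proof.
move=> b_inj /fin_all_exists[f fP].
have f_inj : injective f by move=> i j e; apply: b_inj; rewrite -!fP e.
pose s := perm f_inj.
have -> : \matrix_(i, l) G (b i) (b l) = row_perm s (col_perm s (\matrix_(i, l) G (a i) (a l))).
  by apply/matrixP => i l; rewrite !mxE !permE !fP.
rewrite row_permE col_permE !det_mulmx !det_perm odd_permV.
by rewrite mulrCA -signr_addb addbb mulr1.
Qed.

Variables (F : numFieldType) (M : nat).

Lemma gpoly2_same (o : bool) a b :
  gpoly F 2 M (2 * a + o) (2 * b + o) = gpoly F 1 M a b.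
Proof.
apply: eq_bigr => p _; apply: eq_bigr => q _.
by congr (if _ then _ else _); apply/eqP/eqP; lia.
Qed.

Lemma gpoly2_diff (o : bool) a b : gpoly F 2 M (2 * a + o) (2 * b + ~~ o) = 0.
Proof.
rewrite /gpoly big1 // => p _; rewrite big1 // => q _.
by case: eqP => // e; exfalso; case: o e => /=; lia.
Qed.

(* Truncation of the Toeplitz determinant [D_toeplitz m]; see [gdet_lim]. *)
Definition gdet (m : nat) : {poly F} := \det (\matrix_(i < m, l < m) gpoly F 1 M i l).

(** Listing the even indices first makes the matrix block diagonal, as entries between indices of
    different parity vanish. *)
Lemma det_parity n r s (a : 'I_n -> nat) : n = (r + s)%N ->
  (forall i, (i < r)%N -> exists j, a j = (2 * i)%N) ->
  (forall i, (i < s)%N -> exists j, a j = (2 * i + 1)%N) ->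
  \det (\matrix_(i, l) gpoly F 2 M (a i) (a l)) = gdet r * gdet s.
Proof.
move=> en; move: a; rewrite en => a ev od.
pose b (i : 'I_(r + s)) : nat := match split i with inl j => (2 * j + 0)%N | inr j => (2 * j + 1)%N end.
rewrite (@det_reindex _ (gpoly F 2 M) _ a b); first last.
- move=> i; rewrite /b; case: (split i) => j; last exact: od.
  by have [l e] := ev j (ltn_ord j); exists l; rewrite e addn0.
- move=> i j; rewrite /b => e; rewrite -(splitK i) -(splitK j).
  case: (split i) (split j) e => i' [] j' /= e; try (by exfalso; lia);
    by have -> : i' = j' by apply: val_inj => /=; lia.
have -> : \matrix_(i, l) gpoly F 2 M (b i) (b l) =
   block_mx (\matrix_(i < r, l < r) gpoly F 1 M i l) 0
            0 (\matrix_(i < s, l < s) gpoly F 1 M i l).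
  apply/matrixP=> i l; rewrite !mxE /b.
  case: splitP => i' _; rewrite mxE; case: splitP => l' _; rewrite mxE.
  - exact: (gpoly2_same false).
  - exact: (gpoly2_diff false).
  - exact: (gpoly2_diff true).
  - exact: (gpoly2_same true).
by rewrite det_ublock.
Qed.

Lemma det_parity_id n :
  \det (\matrix_(i < n, l < n) gpoly F 2 M i l) = gdet (uphalf n) * gdet n./2.
Proof.
apply: (det_parity (a := fun i : 'I_n => i)).
- by rewrite uphalf_half; have := odd_double_half n; lia.
- move=> i ir; have lt : (2 * i < n)%N by move: ir; rewrite uphalf_half; have := odd_double_half n; lia.
  by exists (Ordinal lt).
- move=> i ir; have lt : (2 * i + 1 < n)%N by have := odd_double_half n; lia.
  by exists (Ordinal lt).
Qed.

(** The indices are [0, .., n-2, n]. For odd [n] they contain one odd number more than even ones;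
    for even [n] they contain [n./2.+1] even numbers and [n./2.-1] odd ones. *)
Lemma det_parity_last n : (0 < n)%N ->
  \det (\matrix_(i < n, l < n)
     gpoly F 2 M (i + (i == n.-1 :> nat)) (l + (l == n.-1 :> nat))) =
  if odd n then gdet n./2 * gdet n./2.+1 else gdet n./2.+1 * gdet n./2.-1.
Proof.
move=> n0; have on := odd_double_half n; have nn : (n.-1 < n)%N by lia.
have E r s : n = (r + s)%N -> (forall i, (i < r)%N -> (2 * i < n.-1)%N \/ (2 * i = n)%N) ->
   (forall i, (i < s)%N -> (2 * i + 1 < n.-1)%N \/ (2 * i + 1 = n)%N) ->
   \det (\matrix_(i < n, l < n)
     gpoly F 2 M (i + (i == n.-1 :> nat)) (l + (l == n.-1 :> nat))) = gdet r * gdet s.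
  move=> ers ev od.
  have surj c : (c < n.-1)%N \/ c = n -> exists j : 'I_n, (j + (j == n.-1 :> nat))%N = c.
    case=> [lt|->]; last by exists (Ordinal nn); rewrite /= eqxx; lia.
    by have lt' : (c < n)%N := leq_trans lt (leq_pred n); exists (Ordinal lt'); rewrite /= ltn_eqF ?addn0.
  apply: (det_parity (a := fun i : 'I_n => i + (i == n.-1 :> nat))%N) => // i ?; apply: surj.
    exact: ev.
  exact: od.
case: ifP on => o on; apply: E => [|i ?|i ?]; lia.
Qed.

End ParitySplit.

Section GpolyCoef.
Variable F : numFieldType.

Lemma bin_over_fact p d : (p <= d)%N ->
  ((p`!)%:R * ((d - p)`!)%:R)^-1 = ('C(d, p))%:R / (d`!)%:R :> F.
Proof.
move=> pd; rewrite -(bin_fact pd) !natrM.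
have nz k : (k`!)%:R != 0 :> F by rewrite pnatr_eq0 -lt0n fact_gt0.
have b0 : ('C(d, p))%:R != 0 :> F by rewrite pnatr_eq0 -lt0n bin_gt0.
by field; rewrite b0 !nz.
Qed.

Lemma coef_gpoly M a b d : (gpoly F 1 M a b)`_d =
  \sum_(p < d.+1) if [&& (p <= M)%N, (d - p <= M)%N & (p + a == (d - p) + b)%N]
    then ('C(d, p))%:R / (d`!)%:R else 0.
Proof.
pose G p : F := if (p + a == (d - p) + b)%N then ('C(d, p))%:R / (d`!)%:R else 0.
transitivity (\sum_(p < M.+1) if (p < d.+1)%N && (d - p <= M)%N then G p else 0).
  rewrite coef_sum; apply: eq_bigr => p _; rewrite coef_sum.
  case: ifP => [/andP[pd dM]|nd].
    have dM' : (d - p < M.+1)%N by [].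
    rewrite (bigD1 (Ordinal dM')) //= big1 ?addr0 => [|q nq].
      rewrite !mul1n /G; case: ifP => _; last by rewrite coef0.
      by rewrite coefZ coefXn subnKC // eqxx mulr1 bin_over_fact.
    case: ifP => _; last by rewrite coef0.
    rewrite coefZ coefXn; case: eqP => [e|]; last by rewrite mulr0.
    by case/eqP: nq; apply: val_inj; rewrite /= e addKn.
  rewrite big1 // => q _; case: ifP => _; last by rewrite coef0.
  rewrite coefZ coefXn; case: eqP => [e|]; last by rewrite mulr0.
  by move: nd; rewrite e addKn ltnS leq_addr -ltnS ltn_ord.
rewrite -big_mkcond (big_ord_widen_cond (M.+1 + d.+1) (fun p => (p < d.+1)%N && (d - p <= M)%N) G) ?leq_addr //.
rewrite [LHS]big_mkcond /=.
pose H p : F := if [&& (p <= M)%N, (d - p <= M)%N & (p + a == (d - p) + b)%N]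
    then ('C(d, p))%:R / (d`!)%:R else 0.
rewrite (big_ord_widen (M.+1 + d.+1) H) ?leq_addl // [RHS]big_mkcond /=.
apply: eq_bigr => p _; rewrite /G /H !ltnS.
by case: (p <= d)%N; case: (p <= M)%N; case: (d - p <= M)%N.
Qed.

(** The admissible [p] select some of the binomial coefficients of row [d], whose total is 2^d. The
    bound does not depend on [M]. *)
Lemma norm_coef_gpoly M a b d : `|(gpoly F 1 M a b)`_d| <= (2 ^ d)%:R / (d`!)%:R.
Proof.
rewrite coef_gpoly; apply: le_trans (ler_norm_sum _ _ _) _.
have -> : (2 ^ d)%:R / (d`!)%:R = \sum_(p < d.+1) ('C(d, p))%:R / (d`!)%:R :> F.
  rewrite -mulr_suml -natr_sum -[2%N]/(1 + 1)%N expnDn; congr (_%:R / _).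
  by apply: eq_bigr => p _; rewrite !exp1n !muln1.
apply: ler_sum => p _; case: ifP => _; last by rewrite normr0 divr_ge0 ?ler0n.
by rewrite normrM normfV !normr_nat.
Qed.

End GpolyCoef.

(** * Odd permutations as the centralizer of negation *)

Section BCount.
Variable N : nat.
Local Notation T := (sym_point N).

Lemma mem_sym_range (m : int) :
  (m \in sym_range N) = (`|m| <= N./2)%N && (odd N || (m != 0)).
Proof.
rewrite mem_filter andbC; congr (_ && _).
apply/mapP/idP => [[j]|le]; first by rewrite mem_iota => /andP[_ lt] ->; lia.
by exists (absz (m + (N./2)%:Z)); [rewrite mem_iota|]; lia.
Qed.

Lemma opp_sym_range m : m \in sym_range N -> - m \in sym_range N.
Proof. by rewrite !mem_sym_range abszN oppr_eq0. Qed.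

Definition sym_opp (x : T) : T := SeqSub (opp_sym_range (ssvalP x)).

Lemma sym_oppK : involutive sym_opp.
Proof. by move=> x; apply: val_inj; rewrite /= opprK. Qed.

Definition sym_oppp : {perm T} := perm (inv_inj sym_oppK).

Lemma sym_opppE x : val (sym_oppp x) = - val x.
Proof. by rewrite permE. Qed.

Lemma sym_opppV : (sym_oppp^-1 = sym_oppp)%g.
Proof.
apply/eqP; rewrite eq_invg_mul; apply/eqP/permP => x.
by rewrite permM perm1 !permE sym_oppK.
Qed.

Lemma odd_symmetricE (s : {perm T}) :
  odd_symmetric s = ((sym_oppp * s * sym_oppp^-1)%g == s).
Proof.
have E : odd_symmetric s <-> forall x, s (sym_oppp x) = sym_oppp (s x).
  split=> [/forallP H x|H].
    move/forallP/(_ (sym_oppp x))/implyP: (H x); rewrite sym_opppE eqxx => /(_ isT)/eqP e.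
    by apply: val_inj; rewrite e sym_opppE.
  apply/forallP => x; apply/forallP => x'; apply/implyP => /eqP ex.
  have -> : x' = sym_oppp x by apply: val_inj; rewrite sym_opppE.
  by rewrite H sym_opppE.
have oppK x : sym_oppp (sym_oppp x) = x by rewrite !permE sym_oppK.
apply/idP/eqP => [/E H|H].
  by apply/permP => x; rewrite sym_opppV !permM H oppK.
by apply/E => x; rewrite -[in RHS]H sym_opppV !permM oppK.
Qed.

(** Oddness is commutation with the negation [sym_oppp]. Conjugation by it reverses both positions
    and values, hence carries increasing subsequences to increasing ones, as [card_conj_fixed]
    requires. *)
Lemma b_count_Psi (F : numClosedFieldType) n : (0 < n)%N ->
  (b_count N n)%:R = Psi n F sym_oppp sym_oppp.
Proof.
move=> n0; rewrite -(card_conj_fixed (nu := val : T -> int) F val_inj n0) => [|s].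
  congr _%:R; apply: eq_card => s; rewrite !inE odd_symmetricE andbC.
  by [].
rewrite !inE => /forallP sB; apply/forallP => A; apply/implyP => /incr_onP iA.
have := sB (sym_oppp @: A); rewrite card_imset; last exact: perm_inj.
move/implyP; apply; apply/incr_onP => _ _ /imsetP[x xA ->] /imsetP[y yA ->].
rewrite !sym_opppE ltrN2 => /(iA y x yA xA).
by rewrite sym_opppV !permM !sym_opppE ltrN2.
Qed.

(** The layout expected by [sum_fixed_words]: opposite pairs and, for odd [N], the fixed point 0;
    thus [m] is to be [odd N]. *)
Definition sym_code m (j : ('I_N./2 + 'I_N./2) + 'I_m) : int :=
  match j with
  | inl (inl i) => i.+1%:Z | inl (inr i) => - i.+1%:Z | inr _ => 0
  end.

Lemma sym_code_bij m : m = odd N :> nat ->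
  exists e : ('I_N./2 + 'I_N./2) + 'I_m -> T,
    bijective e /\ (forall j, val (e j) = sym_code j).
Proof.
move=> em.
have codeP j : sym_code (m := m) j \in sym_range N.
  rewrite mem_sym_range; case: j => [[i|i]|i] /=; have := ltn_ord i; lia.
exists (fun j => SeqSub (codeP j)); split=> //.
have inj : injective (fun j => SeqSub (codeP j)).
  move=> j j' /(congr1 val) /=; case: j j' => [[i|i]|i] [[i'|i']|i'] /= e; try (by exfalso; lia).
  - by have -> : i = i' by apply: val_inj => /=; lia.
  - by have -> : i = i' by apply: val_inj => /=; lia.
  - by have -> : i = i' by apply: val_inj => /=; have := ltn_ord i; have := ltn_ord i'; lia.
have /fin_all_exists[g gP] : forall x : T, exists j, SeqSub (codeP j) = x.
  move=> x; suff [j jP] : exists j, sym_code (m := m) j = val x by exists j; apply: val_inj.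
  have : val x \in sym_range N := ssvalP x.
  rewrite mem_sym_range; move: (val x) => y yP.
  have [y0|y0|y0] := ltrgt0P y.
  - have lt : (`|y|.-1 < N./2)%N by lia.
    by exists (inl (inl (Ordinal lt))) => /=; lia.
  - have lt : (`|y|.-1 < N./2)%N by lia.
    by exists (inl (inr (Ordinal lt))) => /=; lia.
  - have lt : (0 < m)%N by lia.
    by exists (inr (Ordinal lt)).
by exists g => // j; apply: inj; rewrite gP.
Qed.

Lemma b_count_coef (F : numClosedFieldType) n M : (0 < n)%N -> (N./2 <= M)%N ->
  (b_count N n)%:R = ((N./2)`!)%:R ^+ 2 *
   (if ~~ odd N then gdet F M (uphalf n) * gdet F M n./2
    else if odd n then gdet F M n./2 * gdet F M n./2.+1
    else gdet F M n./2.+1 * gdet F M n./2.-1)`_(2 * N./2) :> F.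
Proof.
move=> n0 NM; rewrite (b_count_Psi F n0).
case oN : (odd N) => /=.
  have [e [e_bij eE]] := @sym_code_bij 1 (esym (congr1 nat_of_bool oN)).
  rewrite (Psi_words_odd F NM n0 e_bij) ?det_parity_last //; move=> j; apply: val_inj; rewrite sym_opppE !eE /= ?opprK //.
have [e [e_bij eE]] := @sym_code_bij 0 (esym (congr1 nat_of_bool oN)).
rewrite (Psi_words_even n F NM e_bij) ?det_parity_id //; move=> j; apply: val_inj; rewrite sym_opppE !eE /= ?opprK //.
Qed.

End BCount.

(** * Fourier coefficients and convergence *)

Local Open Scope classical_set_scope.
Local Open Scope ring_scope.

Section Taylor.
Variable R : realType.
Implicit Types (a b x y : R).

Lemma is_derive_horner (p : {poly R}) x : is_derive x 1 (horner p) p^`().[x].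
Proof.
apply: DeriveDef; first exact: derivable_horner.
by rewrite -derive1E -derive.derivE.
Qed.

Lemma is_derive_mono (g dg : R -> R) x : 0 <= x -> (forall y, is_derive y 1 g (dg y)) ->
  (forall y, 0 <= y <= x -> 0 <= dg y) -> g 0 <= g x.
Proof.
move=> x0 dgP dg0.
have cg : {within `[0, x], continuous g}.
  by apply: derivable_within_continuous => y _; exact: ex_derive.
have [c cx e] := @MVT_segment R g dg 0 x x0 (fun y _ => dgP y) cg.
rewrite -subr_ge0 e subr0 mulr_ge0 // dg0 //; move: cx; rewrite in_itv.
Qed.

Lemma norm_le_poly (f df : R -> R) (q : {poly R}) x : 0 <= x ->
  (forall y, is_derive y 1 f (df y)) -> f 0 = 0 -> q.[0] = 0 ->
  (forall y, 0 <= y <= x -> `|df y| <= q^`().[y]) -> `|f x| <= q.[x].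
Proof.
move=> x0 fd f0 q0 le; rewrite ler_norml; apply/andP; split.
- have dg y : is_derive y 1 (horner q + f) (q^`().[y] + df y).
    exact: is_deriveD (is_derive_horner q y) (fd y).
  have := is_derive_mono x0 dg; rewrite /= !fctE f0 q0 addr0 -subr_ge0.
  have le' y : 0 <= y <= x -> 0 <= q^`().[y] + df y.
    by move=> /le; rewrite ler_norml => /andP[? _]; lra.
  by move=> /(_ le'); lra.
- have dg y : is_derive y 1 (horner q - f) (q^`().[y] - df y).
    exact: is_deriveB (is_derive_horner q y) (fd y).
  have := is_derive_mono x0 dg; rewrite /= !fctE f0 q0.
  have le' y : 0 <= y <= x -> 0 <= q^`().[y] - df y.
    by move=> /le; rewrite ler_norml => /andP[? ?]; lra.
  by move=> /(_ le'); lra.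
Qed.

Variable t : R[i].
Let a := complex.Re t.
Let b := complex.Im t.

(** [texp_re] and [texp_im] are the real and imaginary parts of the Taylor polynomial with [J] terms
    of exp (t x), for real [x]. *)
Definition texp_re (J : nat) : {poly R} := \poly_(j < J) (complex.Re (t ^+ j) / j`!%:R).
Definition texp_im (J : nat) : {poly R} := \poly_(j < J) (complex.Im (t ^+ j) / j`!%:R).

Lemma cReM (z w : R[i]) : complex.Re (z * w) =
  complex.Re z * complex.Re w - complex.Im z * complex.Im w.
Proof. by case: z => ? ?; case: w. Qed.

Lemma cImM (z w : R[i]) : complex.Im (z * w) =
  complex.Re z * complex.Im w + complex.Im z * complex.Re w.
Proof. by case: z => ? ?; case: w. Qed.

Lemma deriv_texp_re J : (texp_re J.+1)^`() = a *: texp_re J - b *: texp_im J.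
Proof.
apply/polyP => j; rewrite coef_deriv coefB !coefZ !coef_poly ltnS.
case: ltnP => _; last by rewrite mul0rn !mulr0 subr0.
have f0 : (j`!)%:R != 0 :> R by rewrite pnatr_eq0 -lt0n fact_gt0.
have j0 : (j.+1)%:R != 0 :> R by rewrite pnatr_eq0.
by rewrite exprS cReM factS natrM -mulr_natr -/a -/b; field; rewrite f0 nat1r j0.
Qed.

Lemma deriv_texp_im J : (texp_im J.+1)^`() = a *: texp_im J + b *: texp_re J.
Proof.
apply/polyP => j; rewrite coef_deriv coefD !coefZ !coef_poly ltnS.
case: ltnP => _; last by rewrite mul0rn !mulr0 addr0.
have f0 : (j`!)%:R != 0 :> R by rewrite pnatr_eq0 -lt0n fact_gt0.
have j0 : (j.+1)%:R != 0 :> R by rewrite pnatr_eq0.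
by rewrite exprS cImM factS natrM -mulr_natr -/a -/b; field; rewrite f0 nat1r j0.
Qed.

Definition texp_bound (X : R) J : R :=
  expR (`|a| * X) * (((`|a| + `|b|) * X) ^+ J / J`!%:R).

(** Induction on [J]: by [deriv_texp_re] and [deriv_texp_im] the derivatives of the remainders with
    [J.+1] terms are combinations of those with [J] terms, with coefficients of modulus |a| and |b|;
    the mean value bound [norm_le_poly] integrates the estimate. *)
Lemma texp_ge0 X x J : 0 <= x <= X ->
  `|expR (a * x) * cos (b * x) - (texp_re J).[x]| <= texp_bound X J /\
  `|expR (a * x) * sin (b * x) - (texp_im J).[x]| <= texp_bound X J.
Proof.
move=> /andP[x0 xX]; pose m := `|a| + `|b|; pose E := expR (`|a| * X).
have E0 : 0 <= E by rewrite expR_ge0.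
have m0 : 0 <= m by rewrite addr_ge0.
(* The majorant is chosen so that the derivative of [q J.+1] is [m] times [q J], and [q 0] bounds
   exp (a x). *)
pose q J : {poly R} := (E * (m ^+ J / J`!%:R)) *: 'X^J.
have qE k y : (q k).[y] = E * ((m * y) ^+ k / k`!%:R).
  by rewrite /q hornerZ hornerXn exprMn; ring.
suff [le1 le2] : `|expR (a * x) * cos (b * x) - (texp_re J).[x]| <= (q J).[x] /\
  `|expR (a * x) * sin (b * x) - (texp_im J).[x]| <= (q J).[x].
  have qX : (q J).[x] <= texp_bound X J.
    rewrite qE /texp_bound ler_wpM2l // ler_wpM2r ?invr_ge0 ?ler0n //.
    by apply: lerXn2r; rewrite ?nnegrE ?mulr_ge0 // ?(le_trans x0) // ler_wpM2l.
  by split; exact: le_trans qX.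
elim: J x x0 xX => [|J IH] x x0 xX.
  have ea : expR (a * x) <= E.
    by rewrite ler_expR (le_trans (ler_norm _)) // normrM (ger0_norm x0) ler_wpM2l.
  have t0re : texp_re 0 = 0 by rewrite /texp_re poly_def big_ord0.
  have t0im : texp_im 0 = 0 by rewrite /texp_im poly_def big_ord0.
  rewrite t0re t0im !horner0 !qE expr0 fact0 divr1 mulr1 !subr0.
  rewrite !normrM !(ger0_norm (expR_ge0 _)); split.
    by rewrite -[leRHS]mulr1 ler_pM ?expR_ge0 ?normr_ge0 // ler_norml cos_geN1 cos_le1.
  by rewrite -[leRHS]mulr1 ler_pM ?expR_ge0 ?normr_ge0 // ler_norml sin_geN1 sin_le1.
have dU y : is_derive y 1 (fun y => expR (a * y) * cos (b * y))
    (a * (expR (a * y) * cos (b * y)) - b * (expR (a * y) * sin (b * y))).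
  apply: is_derive_eq; rewrite /GRing.scale /=; ring.
have dV y : is_derive y 1 (fun y => expR (a * y) * sin (b * y))
    (a * (expR (a * y) * sin (b * y)) + b * (expR (a * y) * cos (b * y))).
  apply: is_derive_eq; rewrite /GRing.scale /=; ring.
have q0 : (q J.+1).[0] = 0 by rewrite /q hornerZ hornerXn expr0n mulr0.
have q' y : (q J.+1)^`().[y] = m * (q J).[y].
  rewrite /q derivZ derivXn hornerZ hornerMn hornerXn hornerZ hornerXn factS natrM -mulr_natr.
  have f0 : (J`!)%:R != 0 :> R by rewrite pnatr_eq0 -lt0n fact_gt0.
  have j0 : (J.+1)%:R != 0 :> R by rewrite pnatr_eq0.
  by rewrite exprS; field; rewrite f0 nat1r j0.
have bound (r s : R) y : 0 <= y <= x -> `|r| <= (q J).[y] -> `|s| <= (q J).[y] ->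
    `|a * r - b * s| <= (q J.+1)^`().[y] /\ `|a * s + b * r| <= (q J.+1)^`().[y].
  move=> _ hr hs; rewrite q' /m mulrDl; split.
    by rewrite (le_trans (ler_normB _ _)) // !normrM lerD // ler_wpM2l.
  by rewrite (le_trans (ler_normD _ _)) // !normrM lerD // ler_wpM2l.
have IH' y : 0 <= y <= x -> _ := fun h => IH y (andP h).1 (le_trans (andP h).2 xX).
split.
- apply: (norm_le_poly (f := fun y => expR (a * y) * cos (b * y) - (texp_re J.+1).[y])
    (df := fun y => (a * (expR (a * y) * cos (b * y)) - b * (expR (a * y) * sin (b * y)))
                    - (texp_re J.+1)^`().[y])) => //.
  + rewrite !mulr0 expR0 cos0 mul1r horner_coef0 coef_poly expr0 fact0 ?mulr1n divr1.
    by rewrite /= subrr.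
  + move=> y hy; have [h1 h2] := IH' y hy.
    rewrite deriv_texp_re hornerD hornerN !hornerZ.
    by have [le _] := bound _ _ y hy h1 h2; apply: le_trans le; rewrite le_eqVlt; apply/orP; left; apply/eqP; congr `|_|; ring.
- apply: (norm_le_poly (f := fun y => expR (a * y) * sin (b * y) - (texp_im J.+1).[y])
    (df := fun y => (a * (expR (a * y) * sin (b * y)) + b * (expR (a * y) * cos (b * y)))
                    - (texp_im J.+1)^`().[y])) => //.
  + rewrite !mulr0 expR0 sin0 mulr0 horner_coef0 coef_poly expr0 fact0 ?mulr1n divr1.
    by rewrite /= subrr.
  + move=> y hy; have [h1 h2] := IH' y hy.
    rewrite deriv_texp_im hornerD !hornerZ.
    by have [_ le] := bound _ _ y hy h1 h2; apply: le_trans le; rewrite le_eqVlt; apply/orP; left; apply/eqP; congr `|_|; ring.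
Qed.

End Taylor.

Section Cexp.
Variable R : realType.
Local Notation C := R[i].
Local Open Scope complex_scope.
Implicit Types (t z w : C) (x y : R).

Lemma eq_ReIm z w : complex.Re z = complex.Re w -> complex.Im z = complex.Im w -> z = w.
Proof. by case: z w => a b [c d] /= -> ->. Qed.

Lemma cReD z w : complex.Re (z + w) = complex.Re z + complex.Re w.
Proof. by case: z; case: w. Qed.

Lemma cImD z w : complex.Im (z + w) = complex.Im z + complex.Im w.
Proof. by case: z; case: w. Qed.

Lemma cRe_sum (I : Type) (r : seq I) (P : pred I) (F : I -> C) :
  complex.Re (\sum_(i <- r | P i) F i) = \sum_(i <- r | P i) complex.Re (F i).
Proof. by apply: (big_morph (@complex.Re R)) => // *; exact: cReD. Qed.

Lemma cIm_sum (I : Type) (r : seq I) (P : pred I) (F : I -> C) :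
  complex.Im (\sum_(i <- r | P i) F i) = \sum_(i <- r | P i) complex.Im (F i).
Proof. by apply: (big_morph (@complex.Im R)) => // *; exact: cImD. Qed.

Lemma cexp_real t x : cexp (t * x%:C) =
  (expR (complex.Re t * x) * cos (complex.Im t * x)) +i*
  (expR (complex.Re t * x) * sin (complex.Im t * x)).
Proof.
by case: t => a b; apply: eq_ReIm; rewrite /cexp !(cReM, cImM) /=;
  rewrite !(mulr0, mul0r, subr0, add0r, addr0).
Qed.

Definition texp J z : C := \sum_(j < J) z ^+ j / (j`!)%:R.

Lemma real_complex_nat n : (n%:R : C) = (n%:R)%:C.
Proof. by rewrite rmorph_nat. Qed.

Lemma texp_horner t x J :
  texp J (t * x%:C) = (texp_re t J).[x] +i* (texp_im t J).[x].
Proof.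
have E j : (t * x%:C) ^+ j / (j`!)%:R = t ^+ j * (x ^+ j / (j`!)%:R)%:C.
  by rewrite exprMn -rmorphXn real_complex_nat -mulrA rmorphM fmorphV.
have ReR (u : C) y : complex.Re (u * y%:C) = complex.Re u * y.
  by rewrite cReM /= mulr0 subr0.
have ImR (u : C) y : complex.Im (u * y%:C) = complex.Im u * y.
  by rewrite cImM /= mulr0 add0r.
apply: eq_ReIm; rewrite /texp ?cRe_sum ?cIm_sum /= !horner_poly;
  by apply: eq_bigr => j _; rewrite E ?ReR ?ImR; ring.
Qed.

(** Negative [x] is reduced to [texp_ge0] by changing the sign of [t]. The range 2 is that of
    [2 * cos x]. *)
Lemma cexp_texp t x J : `|x| <= 2 ->
  `|complex.Re (cexp (t * x%:C) - texp J (t * x%:C))| <= texp_bound t 2 J /\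
  `|complex.Im (cexp (t * x%:C) - texp J (t * x%:C))| <= texp_bound t 2 J.
Proof.
have pos (u : C) y : 0 <= y <= 2 ->
    `|complex.Re (cexp (u * y%:C) - texp J (u * y%:C))| <= texp_bound u 2 J /\
    `|complex.Im (cexp (u * y%:C) - texp J (u * y%:C))| <= texp_bound u 2 J.
  by move=> hy; rewrite cexp_real texp_horner /=; exact: texp_ge0.
move=> x2; have [x0|x0] := leP 0 x.
  by apply: pos; rewrite x0 -(ger0_norm x0).
have -> : t * x%:C = (- t) * (- x)%:C by rewrite rmorphN mulrNN.
have -> : texp_bound t 2 J = texp_bound (- t) 2 J.
  by case: (t) => a b; rewrite /texp_bound /= !normrN.
by apply: pos; rewrite -(ltr0_norm x0) x2 normr_ge0.
Qed.

Lemma texp_bound_cvg t X : texp_bound t X @ \oo --> (0 : R).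
Proof.
have e0 y : exp_coeff y @ \oo --> (0 : R).
  exact: cvg_series_cvg_0 (@is_cvg_series_exp_coeff R y).
rewrite -[X in _ --> X](mulr0 (expR (`|complex.Re t| * X))).
exact: cvgMr (e0 _).
Qed.

Definition cont (G : R -> C) : Prop :=
  continuous (fun x => complex.Re (G x) : R) /\ continuous (fun x => complex.Im (G x) : R).

Local Notation D := (`[0, 2 * pi]%classic : set R).
Local Notation mu := (@lebesgue_measure R).

Lemma cont_integrable (f : R -> R) : continuous f -> mu.-integrable D (EFin \o f).
Proof.
move=> cf; apply: continuous_compact_integrable; first exact: segment_compact.
exact: continuous_subspaceT.
Qed.

Lemma contD G H : cont G -> cont H -> cont (fun x => G x + H x).
Proof.
move=> [cG cG'] [cH cH']; split.
- under eq_fun do rewrite cReD; by move=> x; apply: cvgD; [exact: cG|exact: cH].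
- under eq_fun do rewrite cImD; by move=> x; apply: cvgD; [exact: cG'|exact: cH'].
Qed.

Lemma contM G H : cont G -> cont H -> cont (fun x => G x * H x).
Proof.
move=> [cG cG'] [cH cH']; split.
- under eq_fun do rewrite cReM; move=> x; apply: cvgB; apply: cvgM.
  + exact: cG. + exact: cH. + exact: cG'. + exact: cH'.
- under eq_fun do rewrite cImM; move=> x; apply: cvgD; apply: cvgM.
  + exact: cG. + exact: cH'. + exact: cG'. + exact: cH.
Qed.

Lemma cont_cst (c : C) : cont (fun=> c).
Proof. by split=> x; exact: cvg_cst. Qed.

Lemma cont_sum (I : Type) (r : seq I) (F : I -> R -> C) :
  (forall i, cont (F i)) -> cont (fun x => \sum_(i <- r) F i x).
Proof.
move=> cF; elim: r => [|i r IH].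
  by under eq_fun do rewrite big_nil; exact: cont_cst.
by under eq_fun do rewrite big_cons; exact: contD.
Qed.

Lemma cintegralD G H : cont G -> cont H ->
  cintegral D (fun x => G x + H x) = cintegral D G + cintegral D H.
Proof.
move=> [cG cG'] [cH cH']; rewrite /cintegral.
under eq_Rintegral do rewrite cReD.
under [X in _ +i* X]eq_Rintegral do rewrite cImD.
by rewrite !RintegralD //; exact: cont_integrable.
Qed.

Lemma cintegralZ (c : C) G : cont G ->
  cintegral D (fun x => c * G x) = c * cintegral D G.
Proof.
move=> [cG cG']; rewrite /cintegral.
under eq_Rintegral do rewrite cReM.
under [X in _ +i* X]eq_Rintegral do rewrite cImM.
have iG := cont_integrable cG; have iG' := cont_integrable cG'.
have cZ (r : R) (f : R -> R) : continuous f -> mu.-integrable D (EFin \o (fun x => r * f x)).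
  by move=> cf; apply: cont_integrable => x; apply: cvgMr; exact: cf.
rewrite RintegralB ?RintegralD ?RintegralZl //; try exact: cZ.
by apply: eq_ReIm; rewrite ?cReM ?cImM.
Qed.

Lemma cintegral_sum (I : Type) (r : seq I) (F : I -> R -> C) :
  (forall i, cont (F i)) ->
  cintegral D (fun x => \sum_(i <- r) F i x) = \sum_(i <- r) cintegral D (F i).
Proof.
move=> cF; elim: r => [|i r IH].
  rewrite big_nil; have := cintegralZ 0 (cont_cst 0); rewrite !mul0r => E.
  rewrite -[RHS]E; congr cintegral; apply/funext => x.
  by rewrite big_nil.
rewrite big_cons -IH -cintegralD //; last exact: cont_sum.
by congr cintegral; apply/funext => x; rewrite big_cons.
Qed.

Lemma Rintegral_bound (f : R -> R) (e : R) : continuous f ->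
  (forall x, `|f x| <= e) -> `|\int[mu]_(x in D) f x| <= e * (2 * pi).
Proof.
move=> cf fe; apply: le_trans (le_normr_Rintegral _ _) _ => //; first exact: cont_integrable.
have -> : e * (2 * pi) = \int[mu]_(x in D) e.
  rewrite Rintegral_cst //= lebesgue_measure_itv /= lte_fin.
  by rewrite ifT ?mulr_gt0 ?pi_gt0 //= oppr0 addr0.
apply: le_Rintegral => //; apply: cont_integrable => x; last exact: cvg_cst.
by apply: cvg_norm; exact: cf.
Qed.

Definition cis (m : int) x : C := cos (m%:~R * x) +i* sin (m%:~R * x).

Lemma cisD m k x : cis m x * cis k x = cis (m + k) x.
Proof.
by apply: eq_ReIm; rewrite ?cReM ?cImM /= intrD mulrDl ?cosD ?sinD //; ring.
Qed.

Lemma cis0 x : cis 0 x = 1.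
Proof. by rewrite /cis mul0r cos0 sin0. Qed.

Lemma cisX m x j : cis m x ^+ j = cis (m * j%:Z) x.
Proof.
elim: j => [|j IH]; first by rewrite expr0 mulr0 cis0.
by rewrite exprS IH cisD; congr cis; rewrite intS mulrDr mulr1.
Qed.

Lemma cont_cis m : cont (cis m).
Proof.
split=> x /=.
  apply: continuous_comp; last exact: continuous_cos.
  by apply: cvgMr; exact: cvg_id.
apply: continuous_comp; last exact: continuous_sin.
by apply: cvgMr; exact: cvg_id.
Qed.

Lemma cexp_im x : cexp (0 +i* x) = cos x +i* sin x.
Proof. by rewrite /cexp /= expR0 mul1r. Qed.

End Cexp.

Section Fourier.
Variable R : realType.
Local Notation C := R[i].
Local Open Scope complex_scope.
Local Notation D := (`[0, 2 * pi]%classic : set R).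
Local Notation mu := (@lebesgue_measure R).
Implicit Types (t z w : C) (x y : R).

Lemma twopi_gt0 : 0 < 2 * pi :> R.
Proof. by rewrite mulr_gt0 ?pi_gt0. Qed.

Lemma Rintegral_FTC (f F : R -> R) : continuous f ->
  (forall x, is_derive x 1 F (f x)) -> \int[mu]_(x in D) f x = F (2 * pi) - F 0.
Proof.
move=> cf dF; have cF : continuous F.
  by move=> x; apply: differentiable_continuous; apply/derivable1_diffP; exact: ex_derive.
rewrite /Rintegral (@continuous_FTC2 R f F) //=; first exact: twopi_gt0.
- exact: continuous_subspaceT.
- split=> [x _||]; first exact: ex_derive.
  + by apply: cvg_at_right_filter; exact: cF.
  + by apply: cvg_at_left_filter; exact: cF.
- by move=> x _; rewrite derive1E derive_val.
Qed.

Lemma cis_2pi m : cis m (2 * pi) = 1 :> C.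
Proof.
have nat_case (n : nat) : cis n%:Z (2 * pi) = 1 :> C.
  rewrite -[n%:Z]mul1r -cisX /cis mul1r mulrC mulr_natr cos2pi sin2pi.
  by rewrite expr1n.
case: m => n //; rewrite NegzE.
have := cisD (- n.+1%:Z) n.+1 (2 * pi : R).
by rewrite nat_case mulr1 addNr cis0.
Qed.

Lemma cintegral_cis (m : int) :
  cintegral D (cis m) = if m == 0 then (2 * pi)%:C else 0 :> C.
Proof.
case: eqP => [->|/eqP m0].
  rewrite /cintegral.
  under eq_Rintegral do rewrite cis0.
  under [X in _ +i* X]eq_Rintegral do rewrite cis0.
  by rewrite !Rintegral_cst //= lebesgue_measure_itv /= lte_fin twopi_gt0 /= oppr0 addr0 mul1r mul0r.
have mR : m%:~R != 0 :> R by rewrite intr_eq0.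
have [/= c2 s2] : (cos (m%:~R * (2 * pi)) = 1 :> R) /\ (sin (m%:~R * (2 * pi)) = 0 :> R).
  by have [-> ->] := cis_2pi m.
have [cC cS] := @cont_cis R m; rewrite /cintegral.
have dS x : is_derive x 1 (fun x => (m%:~R)^-1 * sin (m%:~R * x)) (complex.Re (cis m x)).
  by apply: is_derive_eq; rewrite /GRing.scale /=; field.
have dC x : is_derive x 1 (fun x => - (m%:~R)^-1 * cos (m%:~R * x)) (complex.Im (cis m x)).
  by apply: is_derive_eq; rewrite /GRing.scale /=; field.
rewrite (Rintegral_FTC cC dS) (Rintegral_FTC cS dC).
by rewrite c2 s2 !mulr0 sin0 cos0 !mulr0 !subrr.
Qed.

Lemma f_symbol_circle t x : f_symbol t (cexp (0 +i* x)) = cexp (t * (2 * cos x)%:C).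
Proof.
have zE : cexp (0 +i* x) = cis 1 x :> C by rewrite cexp_im /cis mul1r.
have zV : (cexp (0 +i* x))^-1 = cis (-1) x :> C.
  have one : cis (-1) x * cis 1 x = 1 :> C by rewrite cisD addNr cis0.
  by rewrite zE -[RHS]mulr1 -(divff (x := cis 1 x)) ?mulrA ?one ?mul1r //;
    apply: contra_eq_neq one => ->; rewrite mulr0 eq_sym oner_neq0.
rewrite /f_symbol zV zE; congr (cexp (_ * _)).
by apply: eq_ReIm; rewrite /cis /= ?mulN1r ?mul1r ?cosN ?sinN ?subrr //; ring.
Qed.

(** The coefficient of z^k in (z + 1/z)^d / d!. The resulting series in [t] is that of the modified
    Bessel function I_k(2t). *)
Definition fcoef (d : nat) (k : int) : C :=
  \sum_(p < d.+1) (('C(d, p))%:R / (d`!)%:R) *+ ((d - p)%:Z - p%:Z == k).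

Lemma fourier_texp t (k : int) J :
  cintegral D (fun x => texp J (t * (2 * cos x)%:C) * cis (- k) x) =
  (2 * pi)%:C * \sum_(d < J) fcoef d k * t ^+ d.
Proof.
have E x : texp J (t * (2 * cos x)%:C) * cis (- k) x =
    \sum_(d < J) \sum_(p < d.+1)
       (t ^+ d * (('C(d, p))%:R / (d`!)%:R)) * cis ((d - p)%:Z - p%:Z - k) x.
  rewrite /texp mulr_suml; apply: eq_bigr => d _.
  have -> : (2 * cos x)%:C = cis 1 x + cis (-1) x.
    by apply: eq_ReIm; rewrite /cis /= ?mulN1r ?mul1r ?cosN ?sinN ?subrr //; ring.
  rewrite exprMn exprDn -mulrA mulr_sumr mulr_suml; apply: eq_bigr => p _.
  rewrite !cisX mul1r mulN1r cisD -(cisD (_ - _) (- k)) -mulr_natr.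
  by ring.
transitivity (cintegral D (fun x => \sum_(d < J) \sum_(p < d.+1)
       (t ^+ d * (('C(d, p))%:R / (d`!)%:R)) * cis ((d - p)%:Z - p%:Z - k) x)).
  by congr cintegral; apply/funext => x.
have ct (c : C) m : cont (fun x => c * cis m x).
  by apply: contM (cont_cst c) (@cont_cis R m).
rewrite cintegral_sum => [|d]; last by apply: cont_sum => p; exact: ct.
rewrite mulr_sumr; apply: eq_bigr => d _.
rewrite cintegral_sum => [|p]; last exact: ct.
rewrite mulr_suml mulr_sumr; apply: eq_bigr => p _.
rewrite cintegralZ; last exact: cont_cis.
rewrite cintegral_cis subr_eq0; case: eqP => _; last by rewrite mulr0n mul0r !mulr0.
by rewrite mulr1n; ring.
Qed.

End Fourier.

Section CvgC.
Variable R : realType.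
Local Notation C := R[i].
Local Open Scope complex_scope.
Implicit Types (u v : nat -> C) (l : C).

Definition cvgC u l : Prop := (u : nat -> C^o) @ \oo --> (l : C^o).

Lemma norm_real_complex (x : R) : `|x%:C| = `|x|%:C.
Proof. by rewrite normc_def /= expr0n addr0 sqrtr_sqr. Qed.

Lemma norm_ReIm (z : C) : `|z| <= (`|complex.Re z| + `|complex.Im z|)%:C.
Proof.
rewrite [z in leLHS]complexE (le_trans (ler_normD _ _)) // normrM rmorphD /= lerD //.
  by rewrite norm_real_complex.
by rewrite norm_real_complex normc_def /= expr0n expr1n add0r sqrtr1 mul1r.
Qed.

Lemma cvgC_norm u l (e : nat -> R) : e @ \oo --> (0 : R) ->
  (forall n, `|u n - l| <= (e n)%:C) -> cvgC u l.
Proof.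
move=> e0 ue; apply/cvgrPdist_lt => eps eps0.
have epsE : eps = (complex.Re eps)%:C.
  by apply: eq_ReIm => //=; rewrite ger0_Im // ltW.
have Reps : 0 < complex.Re eps by move: eps0; rewrite epsE ltcR.
move/cvgrPdist_lt: e0 => /(_ _ Reps); apply: filterS => n.
rewrite sub0r normrN => le; rewrite distrC (le_lt_trans (ue n)) // epsE ltcR.
exact: le_lt_trans (ler_norm _) le.
Qed.

Lemma cvgC_D u v l m : cvgC u l -> cvgC v m -> cvgC (fun n => u n + v n) (l + m).
Proof. exact: cvgD. Qed.

Lemma cvgC_M u v l m : cvgC u l -> cvgC v m -> cvgC (fun n => u n * v n) (l * m).
Proof. exact: cvgM. Qed.

Lemma cvgC_N u l : cvgC u l -> cvgC (fun n => - u n) (- l).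
Proof. exact: cvgN. Qed.

Lemma cvgC_cst l : cvgC (fun=> l) l.
Proof. exact: cvg_cst. Qed.

Lemma cvgC_sum (I : Type) (r : seq I) (u : I -> nat -> C) (l : I -> C) :
  (forall i, cvgC (u i) (l i)) ->
  cvgC (fun n => \sum_(i <- r) u i n) (\sum_(i <- r) l i).
Proof.
move=> ul; elim: r => [|i r IH].
  by under eq_fun do rewrite big_nil; rewrite big_nil; exact: cvgC_cst.
by under eq_fun do rewrite big_cons; rewrite big_cons; exact: cvgC_D (ul i) IH.
Qed.

Lemma cvgC_prod (I : Type) (r : seq I) (u : I -> nat -> C) (l : I -> C) :
  (forall i, cvgC (u i) (l i)) ->
  cvgC (fun n => \prod_(i <- r) u i n) (\prod_(i <- r) l i).
Proof.
move=> ul; elim: r => [|i r IH].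
  by under eq_fun do rewrite big_nil; rewrite big_nil; exact: cvgC_cst.
by under eq_fun do rewrite big_cons; rewrite big_cons; exact: cvgC_M (ul i) IH.
Qed.

Lemma cvgC_det m (A : nat -> 'M[C]_m) (B : 'M[C]_m) :
  (forall i j, cvgC (fun n => A n i j) (B i j)) -> cvgC (fun n => \det (A n)) (\det B).
Proof.
move=> AB; apply: cvgC_sum => s; apply: cvgC_M; first exact: cvgC_cst.
exact: cvgC_prod.
Qed.

End CvgC.

Section FourierLimit.
Variable R : realType.
Local Notation C := R[i].
Local Open Scope complex_scope.
Local Notation D := (`[0, 2 * pi]%classic : set R).

(** The error is an integral of the Taylor remainder of the exponential at [t * (2 * cos x)], which
    is bounded uniformly in [x]. *)
Lemma fourier_coef_lim (t : C) (k : int) :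
  cvgC (fun J => \sum_(d < J) fcoef R d k * t ^+ d) (fourier_coef (f_symbol t) k).
Proof.
pose G J x := (texp J (t * (2 * cos x)%:C) - cexp (t * (2 * cos x)%:C)) * cis (- k) x.
have cE : cont (fun x : R => cexp (t * (2 * cos x)%:C)).
  split=> x; under eq_fun do rewrite cexp_real /=; apply: cvgM.
  - apply: continuous_comp; last exact: continuous_expR.
    by apply: cvgMr; apply: cvgMr; exact: continuous_cos.
  - apply: continuous_comp; last exact: continuous_cos.
    by apply: cvgMr; apply: cvgMr; exact: continuous_cos.
  - apply: continuous_comp; last exact: continuous_expR.
    by apply: cvgMr; apply: cvgMr; exact: continuous_cos.
  - apply: continuous_comp; last exact: continuous_sin.
    by apply: cvgMr; apply: cvgMr; exact: continuous_cos.
have ccos : cont (fun x : R => (2 * cos x)%:C).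
  by split=> x /=; [apply: cvgMr; exact: continuous_cos|exact: cvg_cst].
have cT J : cont (fun x : R => texp J (t * (2 * cos x)%:C)).
  rewrite /texp; apply: cont_sum => j; apply: contM; last exact: cont_cst.
  elim: (nat_of_ord j) => [|j' IH]; first exact: cont_cst.
  under eq_fun do rewrite exprS.
  by apply: contM => //; apply: contM => //; exact: cont_cst.
have cN (H : R -> C) : cont H -> cont (fun x => - H x).
  move=> cH; under eq_fun do rewrite -mulN1r.
  by apply: contM => //; exact: cont_cst.
have cG J : cont (G J).
  by apply: contM; [apply: contD => //; exact: cN|exact: cont_cis].
have diff J : \sum_(d < J) fcoef R d k * t ^+ d - fourier_coef (f_symbol t) k =
    ((2 * pi : R)%:C)^-1 * cintegral D (G J).
  have p0 : (2 * pi : R)%:C != 0 by rewrite (inj_eq (@complexI R)) gt_eqF ?twopi_gt0.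
  have -> : \sum_(d < J) fcoef R d k * t ^+ d = ((2 * pi : R)%:C)^-1 *
      cintegral D (fun x => texp J (t * (2 * cos x)%:C) * cis (- k) x).
    by rewrite fourier_texp mulKf.
  rewrite /fourier_coef -mulrBr; congr (_ * _).
  have -> : cintegral D (fun theta => f_symbol t (cexp (0 +i* theta)) *
       cexp (0 +i* (- (k%:~R * theta)))) =
     cintegral D (fun x => cexp (t * (2 * cos x)%:C) * cis (- k) x).
    congr cintegral; apply/funext => x; rewrite f_symbol_circle cexp_im; congr (_ * _).
    by rewrite /cis mulrNz mulNr.
  rewrite -[X in _ - X]mul1r -mulNr -cintegralZ; last by apply: contM => //; exact: cont_cis.
  rewrite -cintegralD.
  - by congr cintegral; apply/funext => x; rewrite /G; ring.
  - by apply: contM => //; exact: cont_cis.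
  - by apply: contM; [exact: cont_cst|apply: contM => //; exact: cont_cis].
(* One factor 2 comes from the two products in the real or imaginary part of [G J x], the other from
   adding these two parts. *)
pose e J : R := 4 * texp_bound t 2 J.
apply: (@cvgC_norm _ _ _ e).
  by rewrite -[X in _ --> X](mulr0 4); apply: cvgMr; exact: texp_bound_cvg.
move=> J; rewrite diff normrM normfV norm_real_complex (gtr0_norm (twopi_gt0 R)).
have p0 : 0 < (2 * pi : R)%:C by rewrite ltcR twopi_gt0.
rewrite mulrC ler_pdivrMr // -rmorphM.
have GB x : `|complex.Re (G J x)| <= 2 * texp_bound t 2 J /\
            `|complex.Im (G J x)| <= 2 * texp_bound t 2 J.
  have c2 : `|2 * cos x| <= 2.
    by rewrite normrM normr_nat ler_piMr // ler_norml cos_geN1 cos_le1.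
  have [] := cexp_texp t J c2; rewrite /G.
  have -> : cexp (t * (2 * cos x)%:C) - texp J (t * (2 * cos x)%:C) =
     - (texp J (t * (2 * cos x)%:C) - cexp (t * (2 * cos x)%:C)) by rewrite opprB.
  set z := texp _ _ - _; rewrite cReM cImM; have -> : complex.Re (- z) = - complex.Re z by case: z.
  have -> : complex.Im (- z) = - complex.Im z by case: z.
  rewrite !normrN /= => h1 h2.
  have le (r s x' y' : R) : `|r| <= texp_bound t 2 J -> `|s| <= texp_bound t 2 J ->
      `|x'| <= 1 -> `|y'| <= 1 -> `|r * x'| + `|s * y'| <= 2 * texp_bound t 2 J.
    move=> hr hs hx hy; rewrite !normrM mulr2n mulrDl !mul1r lerD //.
      by rewrite -[leRHS]mulr1 ler_pM.
    by rewrite -[leRHS]mulr1 ler_pM.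
  have cos1 y : `|cos y : R| <= 1 by rewrite ler_norml cos_geN1 cos_le1.
  have sin1 y : `|sin y : R| <= 1 by rewrite ler_norml sin_geN1 sin_le1.
  by split; [apply: le_trans (ler_normB _ _) _|apply: le_trans (ler_normD _ _) _]; apply: le.
apply: le_trans (norm_ReIm _) _; rewrite lecR /= /e.
have [GR GI] := cG J.
have := Rintegral_bound GR (fun x => (GB x).1).
have := Rintegral_bound GI (fun x => (GB x).2).
rewrite /=; lra.
Qed.

End FourierLimit.

(** * Passing to the limit in the truncations *)

Section Majorized.
Variable R : realType.
Local Notation C := R[i].
Local Open Scope complex_scope.

(* The coefficients of [p] are bounded by those of the power series of [K exp (A X)]. *)
Definition maj (K A : nat) (p : {poly C}) : Prop :=
  forall d, `|p`_d| <= (K * A ^ d)%:R / (d`!)%:R.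

(** The product of K exp (A X) and K' exp (A' X) is K K' exp ((A + A') X); on coefficients this is
    the binomial formula. *)
Lemma maj_mul K A K' A' p q : maj K A p -> maj K' A' q -> maj (K * K') (A + A') (p * q).
Proof.
move=> pK qK d; rewrite coefMr; apply: le_trans (ler_norm_sum _ _ _) _.
rewrite expnDn big_distrr natr_sum mulr_suml /=; apply: ler_sum => j _.
rewrite normrM; apply: le_trans (ler_pM _ _ (pK (d - j)%N) (qK j)) _ => //.
have jd : (j <= d)%N by rewrite -ltnS.
have := bin_over_fact C jd; rewrite invfM => e.
rewrite le_eqVlt; apply/orP; left; apply/eqP.
transitivity ((K * K' * (A ^ (d - j) * A' ^ j))%:R * (j`!%:R^-1 * (d - j)`!%:R^-1) : C).
  by rewrite !natrM; ring.
by rewrite e !natrM; ring.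
Qed.

Lemma maj1 : maj 1 0 1.
Proof.
move=> d; rewrite coef1; case: d => [|d] /=; last by rewrite normr0 divr_ge0 ?ler0n.
by rewrite normr1 expn0 fact0 divr1.
Qed.

Lemma maj_prod (I : Type) (r : seq I) (p : I -> {poly C}) A :
  (forall i, maj 1 A (p i)) -> maj 1 (size r * A) (\prod_(i <- r) p i).
Proof.
move=> pA; elim: r => [|i r IH]; first by rewrite big_nil; exact: maj1.
by rewrite big_cons mulSn -[1%N]muln1; exact: maj_mul.
Qed.

Lemma maj_gdet M m : maj m`! (m * 2) (gdet C M m).
Proof.
move=> d; rewrite /gdet /determinant coef_sum; apply: le_trans (ler_norm_sum _ _ _) _.
have -> : (m`! * (m * 2) ^ d)%:R / (d`!)%:R =
    \sum_(s : 'S_m) ((m * 2) ^ d)%:R / (d`!)%:R :> C.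
  by rewrite sumr_const card_permT card_ord natrM -mulrA mulr_natl.
apply: ler_sum => s _; rewrite -signr_odd mulr_sign.
have := @maj_prod _ (index_enum 'I_m) (fun i => (\matrix_(i < m, l < m) gpoly C 1 M i l) i (s i)) 2.
have -> : size (index_enum 'I_m) = m by rewrite -[RHS]card_ord cardE enumT.
move=> /(_ _ d); rewrite mul1n => le; case: ifP => _; rewrite ?coefN ?normrN; apply: le;
  by move=> i d'; rewrite mxE mul1n; exact: norm_coef_gpoly.
Qed.

(** The majorant is the same for all [M]: the terms of degree at least [c M] are dominated by a tail
    of the series of K exp (A |t|), and this tail tends to 0. *)
Lemma horner_tail (P : nat -> {poly C}) (c : nat -> nat) K A (t : C) :
  (forall M, maj K A (P M)) -> (forall M, (M <= c M)%N) ->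
  cvgC (fun M => (P M).[t] - \sum_(d < c M) (P M)`_d * t ^+ d) 0.
Proof.
move=> PK cM; pose T : R := complex.Re `|t|; pose y : R := A%:R * T.
have tE : `|t| = T%:C by rewrite /T RRe_real.
have T0 : 0 <= T by rewrite -ler0c -tE normr_ge0.
have y0 : 0 <= y by rewrite mulr_ge0.
pose e M : R := K%:R * (expR y - series (exp_coeff y) M).
have cv : series (exp_coeff y) @ \oo --> expR y by exact: is_cvg_series_exp_coeff.
have nd : nondecreasing_seq (series (exp_coeff y)).
  by apply: nondecreasing_series => n _ _; rewrite /exp_coeff /= divr_ge0 ?exprn_ge0.
apply: (@cvgC_norm _ _ _ e).
  rewrite -[X in _ --> X](mulr0 K%:R); apply: cvgMr.
  by rewrite -[X in _ --> X](subrr (expR y)); apply: cvgB; [exact: cvg_cst|exact: cv].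
move=> M; rewrite subr0; pose s := maxn (size (P M)) (c M).
have cs : (c M <= s)%N by rewrite leq_maxr.
rewrite (@horner_coef_wide _ s) ?leq_maxl //.
rewrite -(big_mkord xpredT (fun d => (P M)`_d * t ^+ d)) -(big_mkord xpredT (fun d => (P M)`_d * t ^+ d)).
rewrite (big_cat_nat (n := c M)) //= addrAC subrr add0r.
apply: le_trans (ler_norm_sum _ _ _) _.
apply: (@le_trans _ _ (K%:R * (\sum_(c M <= d < s) exp_coeff y d))%:C).
  rewrite big_distrr rmorph_sum; apply: ler_sum => d _.
  rewrite normrM normrX tE; apply: le_trans (ler_wpM2r _ (PK M d)) _.
    by rewrite -tE exprn_ge0.
  rewrite /exp_coeff /= /y exprMn natrM natrX !rmorphM fmorphV !rmorphXn !rmorph_nat /=.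
  by rewrite le_eqVlt; apply/orP; left; apply/eqP; ring.
rewrite lecR /e ler_wpM2l ?ler0n //.
have -> : \sum_(c M <= d < s) exp_coeff y d = series (exp_coeff y) s - series (exp_coeff y) (c M).
  by rewrite /series /= [X in _ = X - _](big_cat_nat (n := c M)) //= addrAC subrr add0r.
by rewrite lerB //; [apply: (nondecreasing_cvgn_le nd); exact: cvgP cv|exact: nd].
Qed.

Lemma gpoly_lim (t : C) (a b : nat) :
  cvgC (fun M => (gpoly C 1 M a b).[t]) (fourier_coef (f_symbol t) (a%:Z - b%:Z)).
Proof.
(* Up to degree [M] the truncation has the exact coefficients [fcoef]; the higher degrees fall under
   [horner_tail]. *)
pose S M := \sum_(d < M.+1) (gpoly C 1 M a b)`_d * t ^+ d.
have SE M : S M = \sum_(d < M.+1) fcoef R d (a%:Z - b%:Z) * t ^+ d.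
  apply: eq_bigr => d _; congr (_ * _); rewrite coef_gpoly; apply: eq_bigr => p _.
  have dM : (d <= M)%N by rewrite -ltnS.
  have pd : (p <= d)%N by rewrite -ltnS.
  rewrite (leq_trans pd dM) (leq_trans (leq_subr _ _) dM) /=.
  have -> : (p + a == d - p + b)%N = ((d - p)%:Z - p%:Z == a%:Z - b%:Z) by apply/eqP/eqP; lia.
  by case: eqP; rewrite ?mulr1n ?mulr0n.
have E : (fun M => (gpoly C 1 M a b).[t]) = (fun M => ((gpoly C 1 M a b).[t] - S M) + S M).
  by apply/funext => M; rewrite subrK.
rewrite E -[X in cvgC _ X]add0r; apply: cvgC_D.
  apply: (@horner_tail (fun M => gpoly C 1 M a b) (fun M => M.+1) 1 2) => [M d|//].
  by rewrite mul1n; exact: norm_coef_gpoly.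
have -> : S = (fun M => \sum_(d < M.+1) fcoef R d (a%:Z - b%:Z) * t ^+ d) by apply/funext.
have := @fourier_coef_lim R t (a%:Z - b%:Z).
by rewrite /cvgC -(cvg_shiftS (fun J => \sum_(d < J) fcoef R d (a%:Z - b%:Z) * t ^+ d : C^o)).
Qed.

Lemma gdet_lim (t : C) m : cvgC (fun M => (gdet C M m).[t]) (D_toeplitz m t).
Proof.
have E : (fun M => (gdet C M m).[t]) =
    (fun M => \det (\matrix_(i < m, l < m) (gpoly C 1 M i l).[t])).
  apply/funext => M; rewrite /gdet -horner_evalE -det_map_mx; congr (\det _).
  by apply/matrixP => i l; rewrite !mxE.
rewrite E; apply: cvgC_det => i j; under eq_fun do rewrite mxE.
by rewrite mxE; exact: gpoly_lim.
Qed.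

(** Since odd coefficients vanish, the sum of the first [M] terms of [u] is [Q M] cut off at degree
    [M.*2] and evaluated at [t]; it differs from the full value of [Q M] by a tail tending to 0. *)
Lemma has_sum_even (Q : nat -> {poly C}) K A (t : C) (u : nat -> C) (l : C) :
  (forall M, maj K A (Q M)) ->
  (forall M k, (k <= M)%N -> u k = (Q M)`_(2 * k) * t ^+ (2 * k)) ->
  (forall M d, odd d -> (Q M)`_d = 0) ->
  cvgC (fun M => (Q M).[t]) l -> has_sum u l.
Proof.
move=> QK uE Qodd Ql.
have serE M : series (u : nat -> C^o) M = \sum_(d < M.*2) (Q M)`_d * t ^+ d.
  rewrite /series /= big_mkord.
  have : forall N, (N <= M)%N -> \sum_(k < N) u k = \sum_(d < N.*2) (Q M)`_d * t ^+ d.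
    elim=> [|N IH] NM; first by rewrite !big_ord0.
    rewrite doubleS !big_ord_recr /= IH ?(ltnW NM) // -addrA; congr (_ + _).
    by rewrite (uE M N (ltnW NM)) mul2n (Qodd M N.*2.+1) /= ?odd_double // mul0r addr0.
  by apply.
have le2 M : (M <= M.*2)%N by rewrite -addnn leq_addl.
have tail := horner_tail t QK le2.
have := cvgC_D Ql (cvgC_N tail); rewrite oppr0 addr0.
have -> : (fun M => (Q M).[t] + - ((Q M).[t] - \sum_(d < M.*2) (Q M)`_d * t ^+ d)) =
          series (u : nat -> C^o); last by [].
by apply/funext => M; rewrite serE opprB addrC subrK.
Qed.

End Majorized.

(** * The two generating functions *)

Section Main.
Variable R : realType.
Local Notation C := R[i].
Local Open Scope complex_scope.

Lemma b_series n (N : nat -> nat) (r s : nat) (t : C) :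
  (forall M k, (k <= M)%N -> (b_count (N k) n)%:R =
     (k`!)%:R ^+ 2 * (gdet C M r * gdet C M s)`_(2 * k) :> C) ->
  (forall M d, odd d -> (gdet C M r * gdet C M s)`_d = 0) ->
  has_sum (fun k => (b_count (N k) n)%:R * (t ^+ (2 * k) / (k`!)%:R ^+ 2))
    (D_toeplitz r t * D_toeplitz s t).
Proof.
move=> bE odd0.
apply: (@has_sum_even _ (fun M => gdet C M r * gdet C M s) (r`! * s`!) (r * 2 + s * 2) t).
- by move=> M; apply: maj_mul; exact: maj_gdet.
- move=> M k kM; rewrite (bE M k kM).
  have f0 : (k`!)%:R != 0 :> C by rewrite pnatr_eq0 -lt0n fact_gt0.
  by field.
- exact: odd0.
- under eq_fun do rewrite hornerM; apply: cvgC_M; exact: gdet_lim.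
Qed.

Lemma G_series n (t : C) : (0 < n)%N ->
  has_sum (fun k => (b_count (2 * k) n)%:R * (t ^+ (2 * k) / (k`!)%:R ^+ 2))
    (D_toeplitz (uphalf n) t * D_toeplitz n./2 t).
Proof.
move=> n0; apply: b_series => [M k kM|M d od].
  have k2 : (2 * k)./2 = k by rewrite mul2n doubleK.
  rewrite (b_count_coef (N := 2 * k) C (M := M)) ?k2 //.
  by rewrite mul2n odd_double.
by rewrite -det_parity_id coef_det_gpoly_odd.
Qed.

Lemma H_series n (t : C) : (0 < n)%N ->
  has_sum (fun k => (b_count (2 * k + 1) n)%:R * (t ^+ (2 * k) / (k`!)%:R ^+ 2))
    (if odd n then D_toeplitz n./2 t * D_toeplitz n./2.+1 t
     else D_toeplitz n./2.+1 t * D_toeplitz n./2.-1 t).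
Proof.
move=> n0; have k2 k : (2 * k + 1)./2 = k by rewrite addn1 mul2n /= uphalf_double.
have ok k : odd (2 * k + 1) by rewrite addn1 mul2n /= odd_double.
have := det_parity_last C _ n0.
case: ifP => on parity; apply: b_series => [M k kM|M d od].
- by rewrite (b_count_coef (N := 2 * k + 1) C (M := M)) ?k2 // ok on.
- by rewrite -parity coef_det_gpoly_odd.
- by rewrite (b_count_coef (N := 2 * k + 1) C (M := M)) ?k2 // ok on.
- by rewrite -parity coef_det_gpoly_odd.
Qed.

End Main.

Theorem theorem1 (R : realType) (n : nat) (hn : (1 <= n)%N) (t : R[i]) :
  has_sum (fun k : nat =>
             (b_count (2 * k) n)%:R * (t ^+ (2 * k) / (k`!)%:R ^+ 2))
    (if odd n then D_toeplitz (n.-1)./2 t * D_toeplitz (n.+1)./2 t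
     else D_toeplitz n./2 t ^+ 2)
  /\
  has_sum (fun k : nat =>
             (b_count (2 * k + 1) n)%:R * (t ^+ (2 * k) / (k`!)%:R ^+ 2))
    (if odd n then D_toeplitz (n.-1)./2 t * D_toeplitz (n.+1)./2 t
     else D_toeplitz (n./2).-1 t * D_toeplitz (n./2).+1 t).
Proof.
have := @G_series R n t hn; have := @H_series R n t hn.
case: ifP => on H G.
  have en : n = (n./2).*2.+1 by rewrite -[LHS]odd_double_half on.
  have -> : (n.-1)./2 = n./2 by rewrite {1}en /= doubleK.
  have e1 : (n.+1)./2 = n./2.+1 by rewrite {1}en -doubleS doubleK.
  rewrite e1; split; last exact: H.
  by move: G; rewrite uphalf_half on add1n [X in has_sum _ X]mulrC; exact.
split; last by rewrite [X in has_sum _ X]mulrC; exact: H.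
by move: G; rewrite uphalf_half on add0n expr2; exact.
Qed.
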